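(* There exists a quantum simulation algorithm which, given a 2-colex with $V$ vertices and $F$ faces (through its vertex-face incidence matrix $B$), an inverse temperature $\beta$, couplings $\{J_a\}_{a\in\mathcal{V}}$, an accuracy $\epsilon>0$ and a success probability $p<1$, has runtime $$O\Big(V^3\cdot\frac{1}{\epsilon^2}\cdot\log\frac{1}{1-p}\Big)$$ and outputs an estimate $\mathcal{Z}_{\mathrm{est}}$ of the partition function $\mathcal{Z}$ of the associated 3-body Ising model such that $$|\mathcal{Z}_{\mathrm{est}}-\mathcal{Z}|\le \frac{\gamma}{\sqrt{2^{F-2}}}\cdot\epsilon$$ is satisfied with probability at least $p$, where $$\gamma=\sqrt{2^{F+2}}\prod_{a\in\mathcal{V}}\sqrt{e^{2\beta J_a}+e^{-2\beta J_a}}.$$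
   Context: A 2-colex is a finite connected graph embedded cellularly (all faces are discs) in a closed orientable surface of arbitrary genus $g\ge 0$ such that every vertex has degree 3 and the faces are 3-colorable (each face can be given one of three colors so that faces sharing an edge have different colors). $\mathcal{V}$ and $\mathcal{F}$ are its vertex and face sets, $V=|\mathcal{V}|$, $F=|\mathcal{F}|$. Each vertex $a$ is adjacent to exactly three faces, denoted $\mathfrak{f}_a,\mathfrak{g}_a,\mathfrak{h}_a$. The vertex-face incidence matrix $B$ is the $V\times F$ matrix with $B_{v,\mathfrak{f}}=1$ if $v\in\mathfrak{f}$ and $0$ otherwise. The associated 3-body Ising model: a spin $\sigma_{\mathfrak{f}}\in\{1,-1\}$ is placed on each face; for real (site-dependent) couplings $J_a$, $a\in\mathcal{V}$, the energy of a configuration $\sigma$ is $H(\sigma)=-\sum_{a\in\mathcal{V}}J_a\,\sigma_{\mathfrak{f}_a}\sigma_{\mathfrak{g}_a}\sigma_{\mathfrak{h}_a}$. With real inverse temperature $\beta\ge 0$, $\mathcal{Z}=\sum_{\sigma}e^{-\beta H(\sigma)}$, summed over all $2^F$ configurations. Place a qubit on each vertex, let $X,Z$ be the Pauli matrices, and for each face put $X_{\mathfrak{f}}=\bigotimes_{v\in\mathfrak{f}}X_v$. The color code state is $|\Omega\rangle=N^{-1}\prod_{\mathfrak{f}\in\mathcal{F}}(I+X_{\mathfrak{f}})|0\rangle$, where $|0\rangle$ is the all-zeros basis state and $N>0$ normalizes. Let $$A_a=\frac{1}{\sqrt{e^{2\beta J_a}+e^{-2\beta J_a}}}\begin{pmatrix}e^{\beta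 J_a}&e^{-\beta J_a}\\ e^{-\beta J_a}&-e^{\beta J_a}\end{pmatrix}$$ for $a\in\mathcal{V}$. ''Quantum simulation algorithm'' means a procedure that repeatedly prepares $|\Omega\rangle$ with a quantum circuit, measures the single-qubit observables $A_a$, and classically post-processes the outcomes. Runtime counts one- and two-qubit gates, single-qubit measurements and classical elementary operations (real arithmetic and elementary functions at unit cost). The $O(\cdot)$ refers to the regime $V\to\infty$, $\epsilon\to 0$, $p\to 1$, with an absolute constant. *)

(* Defs.v *)
From HB Require Import structures.
From mathcomp Require Import all_boot all_order all_algebra all_fingroup.
From mathcomp Require Import complex spectral.
From mathcomp Require Import reals sequences exp.
From mathcomp Require Import ring.

Set Implicit Arguments.
Unset Strict Implicit.
Unset Printing Implicit Defensive.

Import Order.TTheory GRing.Theory Num.Theory.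

Local Open Scope ring_scope.
Local Open Scope complex_scope.

(* A graph embedded cellularly in a closed oriented surface is given by its
   rotation system.  A dart is an edge with a chosen end: [vert d] is the vertex
   at that end, [opp d] the same edge seen from its other end, [rot d] the next
   dart around [vert d].  The vertices are the orbits of [rot] and the faces
   (all of them discs) the orbits of [d |-> rot (opp d)], which traces face
   boundaries; both are labelled by ordinals.  The edge of [d] lies between the
   faces [face d] and [face (opp d)], possibly equal a priori, and the darts [d]
   with [vert d = v] enumerate the corners at [v].  Parallel edges are allowed;
   loops are excluded by [degree3] and [colorable] together. *)
Record colex (V F : nat) := Colex {
  dart : finType;
  rot : {perm dart};
  opp : {perm dart};
  vert : dart -> 'I_V;
  face : dart -> 'I_F;
  oppK : involutive opp;
  opp_neq : forall d, opp d != d;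
  vert_orbit : forall d e, (vert d == vert e) = (e \in porbit rot d);
  face_orbit : forall d e, (face d == face e) = (e \in porbit (opp * rot)%g d);
  face_surj : forall f, exists d, face d = f;
  degree3 : forall v, #|[set d | vert d == v]| = 3%N;
  nonempty : (0 < V)%N;
  connected : forall v w,
    connect [rel x y | [exists d, (vert d == x) && (vert (opp d) == y)]] v w;
  colorable : exists col : 'I_F -> 'I_3,
    forall d, col (face d) != col (face (opp d))
}.

Section Colex.
Variables (V F : nat) (G : colex V F).

Definition incident (v : 'I_V) (f : 'I_F) : bool :=
  [exists d : dart G, (vert d == v) && (face d == f)].

Definition incidence : 'M[nat]_(V, F) :=
  \matrix_(v, f) nat_of_bool (incident v f).

End Colex.

Section Ising.
Variables (R : realType) (V F : nat) (G : colex V F).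
Variables (beta : R) (J : 'I_V -> R).

Definition sign (b : bool) : R := (-1) ^+ b.

(* The inner product has exactly three factors, see [card_incident]. *)
Definition energy (s : {ffun 'I_F -> bool}) : R :=
  - \sum_(a < V) J a * \prod_(f | incident G a f) sign (s f).

Definition partition_function : R :=
  \sum_(s : {ffun 'I_F -> bool}) expR (- beta * energy s).

Definition weight (a : 'I_V) : R :=
  Num.sqrt (expR (2 * beta * J a) + expR (- (2 * beta * J a))).

Definition gamma : R := Num.sqrt (2 ^+ (F + 2)) * \prod_(a < V) weight a.

Definition observable (a : 'I_V) : 'M[R]_2 :=
  (weight a)^-1 *: \matrix_(i < 2, j < 2)
    if i == j then (-1) ^+ i * expR (beta * J a) else expR (- (beta * J a)).

End Ising.

Section Qubits.
Variables (R : realType) (n : nat).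

Definition bits := {ffun 'I_n -> bool}.

Definition state := {ffun bits -> R[i]}.

Definition ket0 : state := [ffun x => (x == [ffun=> false])%:R].

Definition sqnorm (psi : state) : R :=
  \sum_x (complex.Re (psi x) ^+ 2 + complex.Im (psi x) ^+ 2).

Definition bit (b : bool) : 'I_2 := inord b.
Definition bit2 (b c : bool) : 'I_4 := inord (2 * b + c).

Definition set_bit (x : bits) (q : 'I_n) (b : bool) : bits :=
  [ffun v => if v == q then b else x v].

Inductive gate :=
| Gate1 (q : 'I_n) (U : 'M[R[i]]_2)
| Gate2 (q r : 'I_n) (U : 'M[R[i]]_4).

Definition gate_ok (g : gate) : bool :=
  match g with
  | Gate1 _ U => U \is unitarymx
  | Gate2 q r U => (q != r) && (U \is unitarymx)
  end.

Definition apply_gate (psi : state) (g : gate) : state :=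
  match g with
  | Gate1 q U =>
    [ffun x : bits => \sum_(b : bool) U (bit (x q)) (bit b) * psi (set_bit x q b)]
  | Gate2 q r U =>
    [ffun x : bits => \sum_(b : bool) \sum_(c : bool)
       U (bit2 (x q) (x r)) (bit2 b c) * psi (set_bit (set_bit x q b) r c)]
  end.

Definition circuit := seq gate.

Definition run_circuit (c : circuit) : state := foldl apply_gate ket0 c.

(* The operator  M_0 (x) ... (x) M_(n-1). *)
Definition tensor (M : 'I_n -> 'M[R[i]]_2) (psi : state) : state :=
  [ffun x : bits => \sum_(y : bits)
     (\prod_(v < n) M v (bit (x v)) (bit (y v))) * psi y].

(* For a symmetric A with A ^+ 2 = 1, the spectral projector of A for the
   eigenvalue (-1) ^+ b; see [observable_sym] and [observableK]. *)
Definition projector (A : 'M[R]_2) (b : bool) : 'M[R[i]]_2 :=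
  map_mx (real_complex R) (2^-1 *: (1 + (-1) ^+ b *: A)).

(* Born rule: probability that measuring A v on every qubit v of the normalized
   state psi yields the outcomes (-1) ^+ (x v). *)
Definition born (A : 'I_n -> 'M[R]_2) (psi : state) (x : bits) : R :=
  sqnorm (tensor (fun v => projector (A v) (x v)) psi).

End Qubits.

Arguments ket0 {R n}.

Section ColorCode.
Variables (R : realType) (V F : nat) (G : colex V F).

Definition pauliX : 'M[R[i]]_2 := \matrix_(i, j) (i != j)%:R.

Definition face_X (f : 'I_F) : state R V -> state R V :=
  tensor (fun v => if incident G v f then pauliX else 1).

Definition color_code_unnormalized : state R V :=
  foldr (fun f psi => psi + face_X f psi) ket0 (enum 'I_F).

Definition color_code_state : state R V :=
  [ffun x => ((Num.sqrt (sqnorm color_code_unnormalized))^-1)%:C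
             * color_code_unnormalized x].

End ColorCode.

(* A real RAM: a finite program over two-dimensional arrays of naturals and of
   reals.  Naturals (addresses and counters) are only added and subtracted, and
   there is no rounding from reals to naturals, so that the unit cost of
   operations on unbounded numbers cannot be exploited through bit tricks.
   The program text contains no real constants. *)

Inductive nexp :=
| NConst (k : nat)
| NGet (arr : nat) (i j : nexp)
| NAdd (e1 e2 : nexp)
| NSub (e1 e2 : nexp).

Inductive rexp :=
| RNat (e : nexp)
| RGet (arr : nat) (i j : nexp)
| RAdd (e1 e2 : rexp)
| RSub (e1 e2 : rexp)
| RMul (e1 e2 : rexp)
| RDiv (e1 e2 : rexp)
| RSqrt (e : rexp)
| RExp (e : rexp)
| RLn (e : rexp).

Inductive bexp :=
| BNatLe (e1 e2 : nexp)
| BRealLe (e1 e2 : rexp)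
| BNot (e : bexp)
| BAnd (e1 e2 : bexp).

Inductive cmd :=
| Skip
| NSet (arr : nat) (i j e : nexp)
| RSet (arr : nat) (i j : nexp) (e : rexp)
| Seq (c1 c2 : cmd)
| If (b : bexp) (c1 c2 : cmd)
| While (b : bexp) (c : cmd).

Fixpoint ncost (e : nexp) : nat :=
  match e with
  | NConst _ => 1
  | NGet _ i j => (ncost i + ncost j).+1
  | NAdd e1 e2 | NSub e1 e2 => (ncost e1 + ncost e2).+1
  end.

Fixpoint rcost (e : rexp) : nat :=
  match e with
  | RNat e => (ncost e).+1
  | RGet _ i j => (ncost i + ncost j).+1
  | RAdd e1 e2 | RSub e1 e2 | RMul e1 e2 | RDiv e1 e2 =>
    (rcost e1 + rcost e2).+1
  | RSqrt e | RExp e | RLn e => (rcost e).+1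
  end.

Fixpoint bcost (e : bexp) : nat :=
  match e with
  | BNatLe e1 e2 => (ncost e1 + ncost e2).+1
  | BRealLe e1 e2 => (rcost e1 + rcost e2).+1
  | BNot e => (bcost e).+1
  | BAnd e1 e2 => (bcost e1 + bcost e2).+1
  end.

Section Machine.
Variable R : realType.

Record mem := Mem {
  nat_mem : nat -> nat -> nat -> nat;
  real_mem : nat -> nat -> nat -> R
}.

Definition upd (T : Type) (m : nat -> nat -> nat -> T) (arr i j : nat) (x : T) :=
  fun arr' i' j' =>
    if [&& arr' == arr, i' == i & j' == j] then x else m arr' i' j'.

Fixpoint neval (s : mem) (e : nexp) : nat :=
  match e with
  | NConst k => k
  | NGet arr i j => nat_mem s arr (neval s i) (neval s j)
  | NAdd e1 e2 => (neval s e1 + neval s e2)%N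
  | NSub e1 e2 => (neval s e1 - neval s e2)%N
  end.

Fixpoint reval (s : mem) (e : rexp) : R :=
  match e with
  | RNat e => (neval s e)%:R
  | RGet arr i j => real_mem s arr (neval s i) (neval s j)
  | RAdd e1 e2 => reval s e1 + reval s e2
  | RSub e1 e2 => reval s e1 - reval s e2
  | RMul e1 e2 => reval s e1 * reval s e2
  | RDiv e1 e2 => reval s e1 / reval s e2
  | RSqrt e => Num.sqrt (reval s e)
  | RExp e => expR (reval s e)
  | RLn e => ln (reval s e)
  end.

Fixpoint beval (s : mem) (e : bexp) : bool :=
  match e with
  | BNatLe e1 e2 => (neval s e1 <= neval s e2)%N
  | BRealLe e1 e2 => reval s e1 <= reval s e2
  | BNot e => ~~ beval s e
  | BAnd e1 e2 => beval s e1 && beval s e2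
  end.

(* [exec c s s' t]: started in s, the program c halts in s' after t operations. *)
Inductive exec : cmd -> mem -> mem -> nat -> Prop :=
| ExecSkip s : exec Skip s s 1
| ExecNSet s arr i j e :
    exec (NSet arr i j e) s
      (Mem (upd (nat_mem s) arr (neval s i) (neval s j) (neval s e)) (real_mem s))
      (ncost i + ncost j + ncost e).+1
| ExecRSet s arr i j e :
    exec (RSet arr i j e) s
      (Mem (nat_mem s) (upd (real_mem s) arr (neval s i) (neval s j) (reval s e)))
      (ncost i + ncost j + rcost e).+1
| ExecSeq c1 c2 s s1 s2 t1 t2 :
    exec c1 s s1 t1 -> exec c2 s1 s2 t2 -> exec (Seq c1 c2) s s2 (t1 + t2)
| ExecIf b c1 c2 s s' t :
    exec (if beval s b then c1 else c2) s s' t ->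
    exec (If b c1 c2) s s' (bcost b + t)
| ExecWhileFalse b c s :
    ~~ beval s b -> exec (While b c) s s (bcost b)
| ExecWhileTrue b c s s1 s2 t1 t2 :
    beval s b -> exec c s s1 t1 -> exec (While b c) s1 s2 t2 ->
    exec (While b c) s s2 (bcost b + t1 + t2).

(* Memory layout (nat arrays N, real arrays X, everything else initially 0):
     input     N 0 0 0 = V, N 0 0 1 = F, N 1 v f = B v f,
               X 0 0 0 = beta, X 0 0 1 = eps, X 0 0 2 = p, X 1 0 a = J a;
     circuit   N 2 0 0 = number of repetitions, N 2 0 1 = number of gates,
               N 3 k 0 = arity of gate k, N 3 k 1 and N 3 k 2 = its qubits,
               X 4 k _ = the entries of its matrix, row by row, real part first;
     outcomes  X 2 k a = outcome (1 or -1) of the measurement on qubit a in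
               repetition k;
     output    X 3 0 0. *)

Definition input_mem (V F : nat) (B : 'M[nat]_(V, F)) (beta : R) (J : 'I_V -> R)
    (eps p : R) : mem :=
  {| nat_mem := fun arr i j =>
       match arr, i, j with
       | 0, 0, 0 => V
       | 0, 0, 1 => F
       | 1, _, _ => if (insub i, insub j) is (Some v, Some f) then B v f else 0
       | _, _, _ => 0
       end%N;
     real_mem := fun arr i j =>
       match arr, i, j with
       | 0%N, 0%N, 0%N => beta
       | 0%N, 0%N, 1%N => eps
       | 0%N, 0%N, 2%N => p
       | 1%N, 0%N, _ => if insub j is Some a then J a else 0
       | _, _, _ => 0
       end |}.

Definition entry (s : mem) (k m : nat) : R[i] :=
  Complex (real_mem s 4 k (2 * m)) (real_mem s 4 k (2 * m).+1).

Definition stores_gate (n : nat) (s : mem) (k : nat) (g : gate R n) : Prop :=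
  match g with
  | Gate1 q U =>
    [/\ nat_mem s 3 k 0 = 1%N, nat_mem s 3 k 1 = q
      & U = \matrix_(i, j) entry s k (2 * i + j)]
  | Gate2 q r U =>
    [/\ nat_mem s 3 k 0 = 2%N, nat_mem s 3 k 1 = q, nat_mem s 3 k 2 = r
      & U = \matrix_(i, j) entry s k (4 * i + j)]
  end.

Definition stores_circuit (n : nat) (s : mem) (c : circuit R n) : Prop :=
  [/\ nat_mem s 2 0 1 = size c, all (@gate_ok R n) c
    & forall k g, onth c k = Some g -> stores_gate s k g].

Definition outcomes (K n : nat) := {ffun 'I_K -> bits n}.

Definition store_outcomes (K n : nat) (s : mem) (w : outcomes K n) : mem :=
  {| nat_mem := nat_mem s;
     real_mem := fun arr i j =>
       if (arr == 2%N, insub i, insub j) is (true, Some k, Some a)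
       then sign R (w k a) else real_mem s arr i j |}.

End Machine.

(* [compile] computes the circuit and the number of repetitions from the input,
   [post] computes the output from the measurement outcomes.  Both are fixed
   programs, used for all inputs of all sizes. *)
Record algorithm := Algorithm { compile : cmd; post : cmd }.

(* Started in memory s0, the algorithm A runs the n-qubit circuit c on |0...0>
   and then measures all n qubits, K times in total; it outputs est w when the
   outcomes are w, and its worst-case runtime is at most T. *)
Definition runs (R : realType) (A : algorithm) (s0 : mem R) (n K : nat)
    (c : circuit R n) (est : outcomes K n -> R) (T : nat) : Prop :=
  exists s1 t1,
    [/\ exec (compile A) s0 s1 t1, nat_mem s1 2 0 0 = K, stores_circuit s1 c
      & forall w, exists s2 t2,
          [/\ exec (post A) (store_outcomes s1 w) s2 t2,
              est w = real_mem s2 3 0 0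
            & (t1 + K * (size c + n) + t2 <= T)%N]].

(* Probability of the event E when psi is prepared and the observables O v are
   measured on it, K times independently. *)
Definition probability (R : realType) (K n : nat) (O : 'I_n -> 'M[R]_2)
    (psi : state R n) (E : pred (outcomes K n)) : R :=
  \sum_(w | E w) \prod_(k < K) born O psi (w k).

Lemma face_rot (V F : nat) (G : colex V F) (d : dart G) :
  face (rot G d) = face (opp G d).
Proof.
apply/eqP; rewrite eq_sym face_orbit; apply/porbitP; exists 1%N.
by rewrite expg1 permM oppK.
Qed.

Lemma card_incident (V F : nat) (G : colex V F) (v : 'I_V) :
  #|[set f | incident G v f]| = 3%N.
Proof.
have [col colP] := colorable G.
have frot (d : dart G) : face (rot G d) != face d.
  by apply: contra_neq (colP d) => <-; rewrite face_rot.
rewrite -[RHS](degree3 G v).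
have -> : [set f | incident G v f] = [set face d | d in [set d : dart G | vert d == v]].
  apply/setP => f; rewrite inE; apply/existsP/imsetP.
    by case=> d /andP[dv /eqP <-]; exists d => //; rewrite inE.
  by case=> d; rewrite inE => dv ->; exists d; rewrite dv /=.
apply: card_in_imset => d e; rewrite !inE => /eqP dv /eqP ev fde.
have orb3 : #|porbit (rot G) d| = 3%N.
  rewrite -(degree3 G v); congr #|pred_of_set _|; apply/setP => x.
  by rewrite inE -vert_orbit dv eq_sym.
have : e \in porbit (rot G) d by rewrite -vert_orbit dv ev.
have rot3 : rot G (rot G (rot G d)) = d.
  by have := iter_porbit (rot G) d; rewrite orb3.
case/porbitP => k ek; move: fde; rewrite {}ek permX.
have -> : iter k (rot G) d = iter (k %% 3) (rot G) d.
  rewrite {1}(divn_eq k 3) addnC iterD; congr iter.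
  by elim: (k %/ 3)%N => //= m ->; exact: rot3.
have : (k %% 3 < 3)%N by rewrite ltn_mod.
case: (k %% 3)%N => [|[|[|]]] //= _ fde.
  by have := frot d; rewrite fde eqxx.
by have := frot (rot G (rot G d)); rewrite rot3 fde eqxx.
Qed.

Lemma observable_sym (R : realType) (V : nat) (beta : R) (J : 'I_V -> R) a :
  (observable beta J a)^T = observable beta J a.
Proof.
by apply/matrixP => i j; rewrite !mxE eq_sym; case: eqP => // ->.
Qed.

Lemma observableK (R : realType) (V : nat) (beta : R) (J : 'I_V -> R) a :
  observable beta J a *m observable beta J a = 1%:M.
Proof.
have wgt : weight beta J a ^+ 2 = expR (beta * J a) ^+ 2 + expR (- (beta * J a)) ^+ 2.
  rewrite sqr_sqrtr ?addr_ge0 ?expR_ge0 //.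
  by rewrite -!expRM_natl mulrN mulrA.
have wn0 : weight beta J a != 0.
  have : 0 < weight beta J a ^+ 2 by rewrite wgt addr_gt0 // exprn_gt0 // expR_gt0.
  by apply: contraTneq => ->; rewrite expr0n ltxx.
rewrite /observable -scalemxAl -scalemxAr scalerA.
set M := \matrix_(i, j) _.
suff -> : M *m M = (weight beta J a ^+ 2)%:M.
  by rewrite scale_scalar_mx -invfM -expr2 mulVf // expf_neq0.
rewrite wgt; apply/matrixP => i j; rewrite !mxE big_ord_recl big_ord1 !mxE.
by case: i => [[|[|]]] //= ?; case: j => [[|[|]]] //= ?;
  rewrite /= ?mulr1n ?mulr0n; ring.
Qed.

(* Main.v *)
(* Write [B s] for the binary vector [v |-> sum of s f over the faces f at v].
   The color code state is proportional to [sum_s |B s>].  Expanding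
   [<Omega| (x)_a A_a |Omega>] over pairs [(s, s + r)], the contribution of the
   pair is [prod_a exp (beta J_a (-1)^(B r)_a)], the Boltzmann weight of [r], times
   a sign that is trivial because any two faces share an even number of
   vertices.  As [B] has a kernel with 4 elements, the expectation of the product
   of the measured outcomes is [Z / (4 prod_a w_a)], where
   [w_a = sqrt (exp (2 beta J_a) + exp (- 2 beta J_a))].  By Hoeffding's
   inequality the average over [O(eps^-2 ln (1 / (1 - p)))] repetitions is
   [eps]-close to it, and [gamma / sqrt (2 ^ (F - 2)) = 4 prod_a w_a].

   The circuit comes from Gaussian elimination on the columns of [B], which takes
   [O(V^3)] steps: a column [m] with pivot [q], such that qubit [q] is still [0],
   is turned into [(1 + X_m) / sqrt 2] by a Hadamard gate on [q] and CNOT gates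
   from [q] to the other elements of [m].  There are [O(V^2)] gates. *)

Require Import Defs.
From mathcomp Require Import all_boot all_order all_algebra.
From mathcomp Require Import reals sequences exp.
From mathcomp Require Import all_fingroup complex spectral.
From mathcomp Require Import ring lra zify.

Set Implicit Arguments.
Unset Strict Implicit.
Unset Printing Implicit Defensive.

Import Order.TTheory GRing.Theory Num.Theory.
Local Open Scope ring_scope.

(** * The binary code spanned by the faces *)

(** Booleans serve throughout as the field with two elements, so [+] on [bool] is exclusive or. The
    sign left over from a pair [(s, s + r)] has exponent [sum_v (B s)_v + (B s)_v (B r)_v], so two
    facts are needed: every codeword has even weight, and any two codewords are orthogonal. Both
    come from one identity, which turns the pairing of [B s] and [B r] into a sum over darts of
    [s f * r f]. Pairing a single color with a different color class gives even weight; as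
    [s f * r f] is again a function on faces, orthogonality then follows from even weight.
    Elimination clears a pivot row only in the later columns. This dictates the order of the blocks,
    from the last face to the first: the pivot qubit of a block is then still 0 when the block runs.
    Dependent columns become zero and merely rescale the unnormalized state. The machine cannot
    round a real to a natural, so the number of repetitions is found by counting up to a real
    threshold, at a cost linear in the result. *)

Definition combine (V F : nat) (M : 'I_F -> bits V) (s : {ffun 'I_F -> bool}) :
    bits V :=
  [ffun v => \sum_f (M f v * s f)].

Lemma combineD (V F : nat) (M : 'I_F -> bits V) s t :
  combine M (s + t) = combine M s + combine M t.
Proof.
apply/ffunP => v; rewrite !ffunE -big_split; apply: eq_bigr => f _.
by rewrite !ffunE mulrDr.
Qed.

Definition face_bits (V F : nat) (G : colex V F) (f : 'I_F) : bits V :=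
  [ffun v => incident G v f].

Section ColexParity.
Variables (V F : nat) (G : colex V F).
Local Notation rt := (Defs.rot G).
Local Notation fc := (@face V F G).
Implicit Types (d e : dart G) (s r : {ffun 'I_F -> bool}).

Lemma mem_porbit_rot v d :
  vert d = v -> [set e | vert e == v] = porbit rt d.
Proof.
by move=> <-; apply/setP => e; rewrite inE -vert_orbit eq_sym.
Qed.

Lemma card_porbit_rot d : #|porbit rt d| = 3%N.
Proof. by rewrite -(mem_porbit_rot erefl) degree3. Qed.

Lemma rot3 d : rt (rt (rt d)) = d.
Proof. by have := iter_porbit rt d; rewrite card_porbit_rot. Qed.

Lemma vert_rot d : vert (rt d) = vert d.
Proof. by apply/eqP; rewrite eq_sym vert_orbit; apply/porbitP; exists 1%N; rewrite expg1. Qed.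

(** A fixed dart would have the same face on both sides of its edge, because [rot d] and [opp d] lie
    on the same face; the coloring forbids this. *)
Lemma rot_neq d : rt d != d.
Proof.
have [col colP] := colorable G.
by apply: contra_neq (colP d) => e; rewrite -face_rot e.
Qed.

Lemma porbit_rotE d : porbit rt d = [set d; rt d; rt (rt d)].
Proof.
apply/eqP; rewrite eq_sym eqEcard card_porbit_rot; apply/andP; split.
  apply/subsetP => e; rewrite !inE => /orP[/orP[]|] /eqP ->.
  - exact: porbit_id.
  - by rewrite -vert_orbit vert_rot.
  - by rewrite -vert_orbit !vert_rot.
have n01 := rot_neq d; have n12 := rot_neq (rt d); have n20 := rot_neq (rt (rt d)).
rewrite rot3 in n20.
by rewrite setUC cardsU1 cards2 !inE negb_or (eq_sym _ d) n20 n12 (eq_sym d) n01.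
Qed.

Lemma vert_rotP d e : vert e = vert d -> [\/ e = d, e = rt d | e = rt (rt d)].
Proof.
move=> vde; have: e \in porbit rt d by rewrite -vert_orbit vde.
rewrite porbit_rotE !inE => /orP[/orP[]|] /eqP ->; by [constructor 1|constructor 2|constructor 3].
Qed.

Lemma sum_vert (U : nmodType) (g : dart G -> U) d :
  \sum_(e | vert e == vert d) g e = g d + g (rt d) + g (rt (rt d)).
Proof.
have n01 := rot_neq d; have n12 := rot_neq (rt d); have n20 := rot_neq (rt (rt d)).
rewrite rot3 in n20.
rewrite (eq_bigl (mem [set d; rt d; rt (rt d)])); last first.
  by move=> e; rewrite -porbit_rotE inE -vert_orbit eq_sym.
rewrite setUC big_setU1 /=; last first.
  by rewrite !inE negb_or (eq_sym _ d) n20 n12.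
by rewrite big_setU1 ?inE 1?eq_sym //= big_set1 addrC.
Qed.

Lemma vertP v : exists d : dart G, vert d = v.
Proof.
have: (0 < #|[set d : dart G | vert d == v]|)%N by rewrite degree3.
by case/card_gt0P => d; rewrite inE => /eqP; exists d.
Qed.

Lemma incident_imset v :
  [set f | incident G v f] = [set fc d | d in [set d : dart G | vert d == v]].
Proof.
apply/setP => f; rewrite inE; apply/existsP/imsetP.
  by case=> d /andP[dv /eqP <-]; exists d => //; rewrite inE.
by case=> d; rewrite inE => dv ->; exists d; rewrite dv /=.
Qed.

(** Three darts map onto three incident faces, so counting gives injectivity. This is what allows
    sums over the faces at a vertex to be rewritten as sums over its darts. *)
Lemma face_inj_vert v :
  {in [set d : dart G | vert d == v] &, injective fc}.
Proof.
by apply/imset_injP; rewrite -incident_imset card_incident degree3.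
Qed.

Lemma sum_incident (U : nmodType) (g : 'I_F -> U) v :
  \sum_(f | incident G v f) g f = \sum_(d | vert d == v) g (fc d).
Proof.
transitivity (\sum_(f in [set f | incident G v f]) g f).
  by apply: eq_bigl => f; rewrite inE.
rewrite incident_imset big_imset; last exact: face_inj_vert.
by apply: eq_bigl => d; rewrite inE.
Qed.

Lemma combine_face s v :
  combine (face_bits G) s v = \sum_(d | vert d == v) s (fc d).
Proof.
rewrite -sum_incident big_mkcond ffunE; apply: eq_bigr => f _; rewrite ffunE.
by case: incident.
Qed.

Lemma sum_darts (U : nmodType) (g : dart G -> U) :
  \sum_(v < V) \sum_(d | vert d == v) g d = \sum_d g d.
Proof. by rewrite (partition_big (@vert V F G) xpredT). Qed.

Lemma addbool (b : bool) : b + b = 0.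
Proof. by case: b. Qed.

(* The sum over v of products of sums over the darts at v has cross terms
   s (face d) * r (face (rot d)); since face (rot d) = face (opp d), those of d
   and of opp d cancel. *)
Lemma sum_combine_mul_darts s r :
  \sum_v combine (face_bits G) s v * combine (face_bits G) r v
  = \sum_(d : dart G) s (fc d) * r (fc d).
Proof.
transitivity (\sum_(v < V) \sum_(d | vert d == v)
  s (fc d) * (r (fc d) + r (fc (rt d)) + r (fc (rt (rt d))))).
  apply: eq_bigr => v _; rewrite !combine_face mulr_suml; apply: eq_bigr => d /eqP dv.
  by congr (_ * _); rewrite -dv -(sum_vert (fun d => r (fc d))).
rewrite sum_darts.
under eq_bigr do rewrite !mulrDr.
rewrite !big_split /=.
have -> : \sum_(d : dart G) s (fc d) * r (fc (rt (rt d))) =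
          \sum_(d : dart G) s (fc d) * r (fc (rt d)).
  rewrite (reindex_inj (@perm_inj _ rt)) /=.
  under eq_bigr do rewrite rot3 face_rot.
  under [RHS]eq_bigr do rewrite face_rot.
  rewrite (reindex_inj (@perm_inj _ (Defs.opp G))) /=.
  by apply: eq_bigr => d _; rewrite oppK.
by rewrite -addrA addbool addr0.
Qed.

End ColexParity.

(** * Parity of codewords from the face coloring *)

Section ColexColors.
Variables (V F : nat) (G : colex V F) (col : 'I_F -> 'I_3).
Hypothesis colP : forall d : dart G, col (face d) != col (face (Defs.opp G d)).
Local Notation rt := (Defs.rot G).
Local Notation fc := (@face V F G).

Lemma col_rot (d : dart G) :
  [/\ col (fc d) != col (fc (rt d)), col (fc (rt d)) != col (fc (rt (rt d)))
    & col (fc (rt (rt d))) != col (fc d)].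
Proof.
have e d' := colP d'; split; first by rewrite face_rot.
  by rewrite (face_rot (rt d)).
by have := colP (rt (rt d)); rewrite -face_rot rot3.
Qed.

Lemma sum_I3 (U : zmodType) (g : 'I_3 -> U) (a b c : 'I_3) :
  a != b -> b != c -> c != a -> g a + g b + g c = \sum_i g i.
Proof.
move=> ab bc ca; rewrite (bigD1 a) //= (bigD1 b) ?(eq_sym b) //= (bigD1 c) /=; last first.
  by rewrite (eq_sym c b) bc ca.
rewrite big1 ?addr0 ?addrA // => i.
move: ab bc ca; clear.
by case: a b c i => [[|[|[|//]]] ?] [[|[|[|//]]] ?] [[|[|[|//]]] ?] [[|[|[|//]]] ?].
Qed.

Definition color_class (c : 'I_3) : {ffun 'I_F -> bool} := [ffun f => col f == c].

(** The three corners of a vertex carry three different colors, so exactly one of them has color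
    [c]. Pairing with a color class therefore measures the parity of a codeword. *)
Lemma combine_color_class c : combine (face_bits G) (color_class c) = [ffun=> true].
Proof.
apply/ffunP => v; rewrite combine_face ffunE.
have [d <-] := vertP G v; rewrite (sum_vert (fun d => color_class c (fc d))) !ffunE.
have [h1 h2 h3] := col_rot d; rewrite (sum_I3 (fun a => a == c) h1 h2 h3).
by rewrite (bigD1 c) //= eqxx big1 // => i /negPf.
Qed.

Lemma sum_combine_aux s : \sum_v combine (face_bits G) s v = \sum_(d : dart G) s (fc d).
Proof.
rewrite -sum_darts; apply: eq_bigr => v _; exact: combine_face.
Qed.

(* Cut s down to one color and pair it with another color class, whose faces
   cover every vertex once: the dart sum vanishes term by term. *)
Lemma sum_combine_col s : \sum_(d : dart G) s (fc d) = 0 :> bool.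
Proof.
pose cut c : {ffun 'I_F -> bool} := [ffun f => (col f == c) * s f].
have cut0 c : \sum_(d : dart G) cut c (fc d) = 0.
  have := sum_combine_mul_darts G (cut c) (color_class (c + 1)).
  rewrite combine_color_class [RHS]big1; last first.
    move=> d _; rewrite !ffunE; case: eqP => [->|_]; last by rewrite !mul0r.
    by case: c => [[|[|[|//]]] ?]; rewrite mulr0.
  under eq_bigr do rewrite [X in _ * X]ffunE [X in _ * X]/= mulr1.
  by rewrite sum_combine_aux.
transitivity (\sum_c \sum_(d : dart G) cut c (fc d)); last by rewrite big1.
rewrite exchange_big; apply: eq_bigr => d _ /=.
rewrite (bigD1 (col (fc d))) //= big1 ?addr0 ?ffunE ?eqxx ?mul1r // => i.
by rewrite ffunE eq_sym => /negPf ->; rewrite mul0r.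
Qed.

End ColexColors.

Section ColexCode.
Variables (V F : nat) (G : colex V F).

Lemma sum_combine s : \sum_v combine (face_bits G) s v = 0.
Proof.
have [col colP] := colorable G; rewrite sum_combine_aux; exact: sum_combine_col colP s.
Qed.

(** The pairing is a dart sum of [s f * r f], which is itself the value of a function on faces; its
    vanishing is thus the parity statement for that function. *)
Lemma sum_combine_mul s r :
  \sum_v combine (face_bits G) s v * combine (face_bits G) r v = 0.
Proof.
rewrite sum_combine_mul_darts.
have [col colP] := colorable G.
have := sum_combine_col colP [ffun f => s f * r f].
by under eq_bigr do rewrite ffunE.
Qed.

(** Every face is traced by at least one dart, and there are three darts per vertex. This turns
    runtimes in [F] and [V] into powers of [V]. *)
Lemma faces_le : (F <= 3 * V)%N.
Proof.
have <- : #|dart G| = (3 * V)%N.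
  rewrite -sum1_card (partition_big (@vert V F G) xpredT) //=.
  under eq_bigr => v _.
    have := degree3 G v; rewrite -sum1dep_card => ->; over.
  by rewrite sum_nat_const card_ord mulnC.
rewrite -[X in (X <= _)%N]card_ord.
have -> : #|'I_F| = #|[set face d | d in dart G]|.
  rewrite -cardsT; apply: eq_card => f; rewrite inE; apply/esym/imsetP.
  by have [d <-] := face_surj G f; exists d.
exact: leq_imset_card.
Qed.

(* A kernel element is a function of the color: the faces at the two ends of an
   edge that do not contain it have the same color and, given the two faces
   along the edge, the same value. *)
Lemma card_ker : #|[set s | combine (face_bits G) s == 0]| = 4.
Proof.
have [col colP] := colorable G.
pose t (u : bool * bool) (c : 'I_3) :=
  if c == 0 then u.1 else if c == 1 then u.2 else u.1 + u.2.
pose sig u : {ffun 'I_F -> bool} := [ffun f => t u (col f)].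
have tsum u : \sum_c t u c = 0.
  by rewrite !big_ord_recl big_ord0 /t /=; case: u => [[] []].
have tE (g : 'I_3 -> bool) : \sum_c g c = 0 -> g =1 t (g 0, g 1).
  rewrite !big_ord_recl big_ord0 addr0 => g0 c; rewrite /t /=.
  case: eqP => [-> //|c0]; case: eqP => [-> //|c1].
  have -> : c = lift ord0 (lift ord0 ord0).
    by apply/val_inj; move/eqP: c0; move/eqP: c1; case: c => [[|[|[|//]]] ?].
  move: g0; rewrite (_ : lift ord0 ord0 = 1); last exact/val_inj.
  by case: (g _); case: (g 1); case: (g _).
have [d0 _] := vertP G (Ordinal (nonempty G)).
have colsur c : exists f, col f = c.
  have [h1 h2 h3] := col_rot colP d0.
  have : [|| c == col (face d0), c == col (face (Defs.rot G d0)) | c == col (face (Defs.rot G (Defs.rot G d0)))].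
    move: h1 h2 h3; move: (col _) (col _) (col _); clear; move: c.
    by case=> [[|[|[|//]]] ?] [[|[|[|//]]] ?] [[|[|[|//]]] ?] [[|[|[|//]]] ?].
  by case/or3P => /eqP ->; eexists.
have siginj : injective sig.
  move=> u w /ffunP e.
  have e' c : t u c = t w c by have [f <-] := colsur c; have := e f; rewrite !ffunE.
  by have := e' 0; have := e' 1; rewrite /t /=; case: u w {e e'} => ? ? [? ?] /= -> ->.
have -> : [set s | combine (face_bits G) s == 0] = [set sig u | u in [set: bool * bool]].
  apply/setP => s; rewrite inE; apply/eqP/imsetP; last first.
    case=> u _ ->; apply/ffunP => v; rewrite combine_face ffunE.
    have [d <-] := vertP G v; rewrite (sum_vert (fun d => sig u (face d))) !ffunE.
    by have [h1 h2 h3] := col_rot colP d; rewrite (sum_I3 (t u) h1 h2 h3).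
  move=> s0.
  have ssum d : s (face d) + s (face (Defs.rot G d)) + s (face (Defs.rot G (Defs.rot G d))) = 0.
    by rewrite -(sum_vert (fun d => s (face d))) -combine_face s0 ffunE.
  pose good u v := forall d : dart G, vert d = v -> s (face d) = t u (col (face d)).
  have good3 u d : s (face d) = t u (col (face d)) ->
      s (face (Defs.rot G d)) = t u (col (face (Defs.rot G d))) -> good u (vert d).
    move=> e1 e2 e /vert_rotP[] -> //.
    have := ssum d; rewrite e1 e2; have [h1 h2 h3] := col_rot colP d.
    have := tsum u; rewrite -(sum_I3 (t u) h1 h2 h3).
    by case: (s _); case: (t u _); case: (t u _); case: (t u _).
  have [u ugood] : exists u, good u (vert d0).
    have [h1 h2 h3] := col_rot colP d0.
    pose g c := \sum_(d : dart G | vert d == vert d0) (s (face d) * (col (face d) == c)).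
    have gE c : g c = s (face d0) * (col (face d0) == c) +
        s (face (Defs.rot G d0)) * (col (face (Defs.rot G d0)) == c) +
        s (face (Defs.rot G (Defs.rot G d0))) * (col (face (Defs.rot G (Defs.rot G d0))) == c).
      by rewrite /g (sum_vert (fun d => s (face d) * (col (face d) == c))).
    have gsum : \sum_c g c = 0.
      rewrite -(sum_I3 g h1 h2 h3) !gE !eqxx (negPf h1) (negPf h2) (negPf h3).
      rewrite (eq_sym (col (face (Defs.rot G d0)))) (negPf h1).
      rewrite (eq_sym (col (face (Defs.rot G (Defs.rot G d0)))) (col (face (Defs.rot G d0)))) (negPf h2).
      rewrite (eq_sym (col (face d0)) (col (face (Defs.rot G (Defs.rot G d0))))) (negPf h3).
      by have := ssum d0; case: (s _); case: (s _); case: (s _).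
    exists (g 0, g 1); apply: good3; rewrite -(tE _ gsum) gE !eqxx.
      rewrite (eq_sym (col (face (Defs.rot G d0)))) (negPf h1) (negPf h3).
      by rewrite !mulr0 mulr1 !addr0.
    rewrite (negPf h1) (eq_sym (col (face (Defs.rot G (Defs.rot G d0))))) (negPf h2).
    by rewrite !mulr0 mulr1 addr0 add0r.
  exists u => //; apply/ffunP => f; rewrite ffunE.
  have [d <-] := face_surj G f.
  suff: good u (vert d) by apply.
  have /connectP[p pP ->] := connected G (vert d0) (vert d).
  elim: p (vert d0) ugood pP => //= y p IHp x ugood /andP[/existsP[e /andP[/eqP ex /eqP ey]]].
  apply: IHp; rewrite -ey; apply: good3.
    by rewrite -face_rot; apply: ugood; rewrite vert_rot.
  by rewrite face_rot oppK; apply: ugood.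
by rewrite card_imset // cardsT card_prod card_bool.
Qed.

End ColexCode.

(** * State preparation *)

Lemma addffb (T : finType) (x : {ffun T -> bool}) : x + x = 0.
Proof. by apply/ffunP => v; rewrite !ffunE addbool. Qed.

Lemma addffbK (T : finType) (x : {ffun T -> bool}) : involutive (+%R^~ x).
Proof. by move=> y; rewrite -addrA addffb addr0. Qed.

Section Superposition.
Local Open Scope complex_scope.
Variables (R : realType) (V F : nat).
Implicit Types (M : 'I_F -> bits V) (x y : bits V).

(** The multiplicity of [x] among the combinations of the columns. The unnormalized state depends on
    [M] only through this function, which is the invariant of the elimination. *)
Definition amplitude M x : R := \sum_(s : {ffun 'I_F -> bool}) (combine M s == x)%:R.

Definition shift (m : bits V) (psi : state R V) : state R V :=
  [ffun x : bits V => psi (x + m)].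

Definition superpose M (l : seq 'I_F) : state R V :=
  foldr (fun f psi => psi + shift (M f) psi) ket0 l.

Lemma sum_amplitude M (h : bits V -> R) :
  \sum_x amplitude M x * h x = \sum_s h (combine M s).
Proof.
under eq_bigr do rewrite mulr_suml.
rewrite exchange_big; apply: eq_bigr => s _ /=.
rewrite (bigD1 (combine M s)) //= eqxx mul1r big1 ?addr0 // => y.
by rewrite eq_sym => /negPf ->; rewrite mul0r.
Qed.

(** Induction over lists of faces, counting the [s] supported on the list. A new face [f] splits
    them by the value [s f]; adding the indicator of [f] carries the half with [s f] true to the
    other half, at the point shifted by [M f]. *)
Lemma superposeE M x : superpose M (enum 'I_F) x = (amplitude M x)%:C.
Proof.
pose sup (l : seq 'I_F) (s : {ffun 'I_F -> bool}) := [forall g, s g ==> (g \in l)].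
suff H l : uniq l -> superpose M l x = (\sum_(s | sup l s) (combine M s == x)%:R)%:C.
  rewrite H ?enum_uniq //; congr (_%:C); apply: eq_bigl => s.
  by apply/forallP => g; rewrite mem_enum implybT.
elim: l x => [|f l IHl] x /=.
  rewrite ffunE (big_pred1 (0 : {ffun 'I_F -> bool})) => [|s].
    rewrite (_ : combine M 0 = [ffun=> false]); last first.
      by apply/ffunP => v; rewrite !ffunE big1 // => g _; rewrite ffunE mulr0.
    by rewrite eq_sym; case: eqP.
  apply/forallP/eqP => [s0|-> g]; last by rewrite ffunE.
  by apply/ffunP => g; have := s0 g; rewrite ffunE in_nil; case: (s g).
move=> /andP[fl ul]; rewrite !ffunE !IHl // -rmorphD /=; congr (_%:C).
rewrite -/(superpose M l).
pose ef : {ffun 'I_F -> bool} := [ffun g => g == f].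
have Mef : combine M ef = M f.
  apply/ffunP => v; rewrite ffunE (bigD1 f) //= ffunE eqxx mulr1 big1 ?addr0 // => g.
  by rewrite ffunE => /negPf ->; rewrite mulr0.
rewrite [RHS](bigID (fun s : {ffun 'I_F -> bool} => s f)) /= addrC; congr (_ + _); last first.
  rewrite (reindex_inj (inv_inj (addffbK ef))) /=; apply: eq_big => [s|s _].
    apply/forallP/andP => [H|[/forallP H sf] g].
      split; last first.
        have := H f; rewrite (negPf fl) implybF.
        by rewrite !ffunE eqxx; case: (s f).
      apply/forallP => g; rewrite inE; have := H g; rewrite !ffunE.
      by case: eqP => _ /=; rewrite ?implybT ?addr0.
    rewrite !ffunE; have := H g; rewrite inE; case: eqP => [->|_] /=.
      by move: sf; case: (s f).
    by rewrite addr0.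
  rewrite combineD Mef; congr (nat_of_bool _)%:R.
  by rewrite (inj_eq (addIr _)).
apply: eq_bigl => s; apply/forallP/andP => [H|[/forallP H sf] g].
  split.
    by apply/forallP => g; apply/implyP => /(implyP (H g)); rewrite inE orbC => ->.
  by apply/negP => /(implyP (H f)); rewrite (negPf fl).
apply/implyP => sg; have := implyP (H g) sg; rewrite inE => /orP[/eqP gf|//].
by rewrite -gf sg in sf.
Qed.

(** A column addition is absorbed by the substitution that adds [s g] to [s f]. It is an involution
    of the selections, so the multiplicities do not change. *)
Lemma amplitude_addcol M M' (f g : 'I_F) :
  f != g -> (forall h, h != g -> M' h = M h) -> M' g = M g + M f ->
  amplitude M' =1 amplitude M.
Proof.
move=> fg Mh Mg x; pose phi (s : {ffun 'I_F -> bool}) : {ffun 'I_F -> bool} :=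
  [ffun h => s h + (h == f) * s g].
have phiK : involutive phi.
  move=> s; apply/ffunP => h; rewrite !ffunE (eq_sym g) (negPf fg) mul0r addr0.
  by rewrite -addrA addbool addr0.
rewrite /amplitude [RHS](reindex_inj (inv_inj phiK)); apply: eq_bigr => s _.
congr (nat_of_bool (_ == _))%:R; apply/ffunP => v; rewrite !ffunE.
rewrite (bigD1 g) //= [RHS](bigD1 g) //= (bigD1 f) //= [X in _ = _ + X](bigD1 f) //=.
rewrite Mg Mh // !ffunE eqxx (eq_sym g) (negPf fg) mul0r mul1r addr0 mulrDl mulrDr.
rewrite -!addrA; congr (_ + _); rewrite [in RHS]addrCA; congr (_ + _).
congr (_ + _); apply: eq_bigr => h /andP[hg hf].
by rewrite Mh // ffunE (negPf hf) mul0r addr0.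
Qed.

End Superposition.

(** * Gates, blocks and the preparation circuit *)

Section Circuit.
Local Open Scope complex_scope.
Variables (R : realType) (V : nat).
Implicit Types (psi : state R V) (x y m : bits V) (q v : 'I_V).

Definition invsqrt2 : R := (Num.sqrt 2)^-1.

Lemma invsqrt2_gt0 : 0 < invsqrt2.
Proof. by rewrite invr_gt0 sqrtr_gt0. Qed.

Lemma sqr_invsqrt2 : invsqrt2 ^+ 2 = 2^-1.
Proof. by rewrite exprVn sqr_sqrtr. Qed.

Definition hadamard : 'M[R[i]]_2 :=
  \matrix_(i, j) (if (i == 1) && (j == 1) then - invsqrt2 else invsqrt2)%:C.

(** The permutation matrix that fixes 0 and 1 and exchanges 2 and 3. As [bit2 b c] is [2 * b + c],
    the first qubit is the control. *)
Definition cnot : 'M[R[i]]_4 :=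
  \matrix_(i, j) (val j == if (val i < 2)%N then val i else (5 - val i)%N)%:R.

Lemma conjC_real (a : R) : Num.conj (a%:C) = a%:C :> R[i].
Proof. exact: conjc_real. Qed.

Lemma hadamard_unitary : hadamard \is unitarymx.
Proof.
apply/unitarymxP/matrixP => i j; rewrite !mxE big_ord_recl big_ord1 !mxE.
rewrite !conjC_real -!rmorphM -rmorphD /=.
rewrite -[RHS]/((i == j)%:R) -(rmorph_nat (real_complex R)); congr (_%:C).
have H : invsqrt2 * invsqrt2 = 2^-1 by rewrite -expr2 sqr_invsqrt2.
by case: i => [[|[|//]] ?]; case: j => [[|[|//]] ?] /=;
  rewrite ?mulrN ?mulNr ?opprK ?H /= ?mulr1n ?mulr0n; field.
Qed.

Lemma cnot_unitary : cnot \is unitarymx.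
Proof.
apply/unitarymxP/matrixP => i j; rewrite !mxE !big_ord_recl big_ord0 !mxE.
by case: i => [[|[|[|[|//]]]] ?]; case: j => [[|[|[|[|//]]]] ?] /=;
  rewrite ?rmorph0 ?rmorph1 ?mulr0 ?mul0r ?mulr1 ?addr0 ?add0r.
Qed.

Lemma bitE (b : bool) : val (bit b) = b.
Proof. by rewrite /bit /= inordK //; case: b. Qed.

Lemma bit2E (b c : bool) : val (bit2 b c) = (2 * b + c)%N.
Proof. by rewrite /bit2 /= inordK //; case: b; case: c. Qed.

Lemma bit_eq (b c : bool) : (bit b == bit c) = (b == c).
Proof. by rewrite -val_eqE !bitE; case: b; case: c. Qed.

(** Only the first column of the matrix meets a nonzero amplitude, so the minus sign of the Hadamard
    gate never shows. *)
Lemma apply_hadamard psi q x :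
  (forall y, y q -> psi y = 0) ->
  apply_gate psi (Gate1 q hadamard) x = invsqrt2%:C * psi (set_bit x q false).
Proof.
move=> psi0; rewrite ffunE big_bool /= (psi0 (set_bit x q true)) ?ffunE ?eqxx //.
by rewrite mulr0 add0r mxE -!val_eqE !bitE andbF.
Qed.

Lemma apply_cnot psi q v x : q != v ->
  apply_gate psi (Gate2 q v cnot) x = psi (x + [ffun w => (w == v) * x q]).
Proof.
move=> qv; rewrite ffunE !big_bool /= !mxE !bit2E.
have E b c : set_bit (set_bit x q b) v c = [ffun w => if w == v then c else if w == q then b else x w].
  by apply/ffunP => w; rewrite !ffunE.
have -> : x + [ffun w => (w == v) * x q] =
    [ffun w => if w == v then x v + x q else if w == q then x q else x w].
  apply/ffunP => w; rewrite !ffunE; case: eqP => [->|_]; first by rewrite mul1r.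
  by rewrite mul0r addr0; case: eqP => [->|].
by rewrite !E; case: (x q); case: (x v); rewrite /= ?mulr0n ?mulr1n ?mul0r ?mul1r ?addr0 ?add0r.
Qed.

Lemma apply_cnots psi q l x : q \notin l -> uniq l ->
  foldl (@apply_gate R V) psi [seq Gate2 q v cnot | v <- l] x
  = psi (x + [ffun w => (w \in l) * x q]).
Proof.
elim: l psi x => [|v l IHl] psi x /=.
  by move=> _ _; congr (psi _); apply/ffunP => w; rewrite !ffunE mul0r addr0.
rewrite inE negb_or => /andP[qv ql] /andP[vl ul]; rewrite IHl // apply_cnot //.
congr (psi _); apply/ffunP => w; rewrite !ffunE (negPf ql) mul0r addr0 inE.
case: eqP => [->|_]; last by rewrite mul0r addr0.
by rewrite (negPf vl) mul0r mul1r addr0.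
Qed.

Definition block q m : circuit R V :=
  Gate1 q hadamard :: [seq Gate2 q v cnot | v <- enum 'I_V & (v != q) && m v].

(* In psi the qubit q is 0, so of the two summands one vanishes at each x. *)
Lemma run_block psi q m : m q -> (forall y, y q -> psi y = 0) ->
  foldl (@apply_gate R V) psi (block q m)
  = [ffun x : bits V => invsqrt2%:C * (psi x + psi (x + m))].
Proof.
move=> mq psi0; apply/ffunP => x; rewrite /= apply_cnots; last first.
- by rewrite filter_uniq ?enum_uniq.
- by rewrite mem_filter eqxx.
rewrite apply_hadamard // ffunE; congr (_ * _).
case: (boolP (x q)) => xq.
  rewrite (psi0 x) // add0r; congr (psi _); apply/ffunP => w; rewrite !ffunE.
  rewrite mem_filter mem_enum andbT; case: eqP => [->|_] /=; first by rewrite xq mq.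
  by rewrite mulr1.
rewrite (psi0 (x + m)) ?ffunE ?(negPf xq) ?mq // addr0; congr (psi _).
apply/ffunP => w; rewrite !ffunE mulr0 addr0.
by case: eqP => [->|//]; rewrite (negPf xq).
Qed.

(** The support of [psi] lies where qubit [q] is 0 and that of its translate by [m] where it is 1.
    The squared norms of the two add up, and the factor [2^-1] restores the total. *)
Lemma sqnorm_block psi q m : m q -> (forall y, y q -> psi y = 0) ->
  sqnorm [ffun x : bits V => invsqrt2%:C * (psi x + psi (x + m))] = sqnorm psi.
Proof.
move=> mq psi0; rewrite /sqnorm.
pose g (z : R[i]) : R := complex.Re z ^+ 2 + complex.Im z ^+ 2.
rewrite -[LHS]/(\sum_x g ([ffun x : bits V => invsqrt2%:C * (psi x + psi (x + m))] x)).
have gh z : g (invsqrt2%:C * z) = 2^-1 * g z.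
  by case: z => a b; rewrite /g /= !mul0r subr0 addr0 -sqr_invsqrt2; ring.
have H x : g ([ffun x : bits V => invsqrt2%:C * (psi x + psi (x + m))] x) =
    2^-1 * (g (psi x) + g (psi (x + m))).
  rewrite ffunE gh; congr (_ * _); case: (boolP (x q)) => xq.
    by rewrite (psi0 x xq) add0r /g /= expr0n /= addr0 add0r.
  rewrite (psi0 (x + m)) ?ffunE ?(negPf xq) ?mq //.
  by rewrite addr0 /g /= expr0n /= !addr0.
under eq_bigr do rewrite H.
rewrite -mulr_sumr big_split /=.
rewrite (_ : \sum_(x : bits V) g (psi (x + m)) = \sum_x g (psi x)); last first.
  by rewrite [RHS](reindex_inj (inv_inj (addffbK m))).
by rewrite -mulr2n mulrnAr -mulrnAl -mulr_natr mulVf ?mul1r ?pnatr_eq0.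
Qed.

Lemma sqnormZ (a : R) psi : sqnorm [ffun x => a%:C * psi x] = a ^+ 2 * sqnorm psi.
Proof.
rewrite /sqnorm mulr_sumr; apply: eq_bigr => x _; rewrite ffunE.
by case: (psi x) => b c /=; rewrite !mul0r subr0 addr0; ring.
Qed.

Lemma sqnorm_ket0 : sqnorm (ket0 : state R V) = 1.
Proof.
rewrite /sqnorm (bigD1 [ffun=> false]) //= ffunE eqxx big1 /= => [|x].
  by rewrite expr1n expr0n !addr0.
by rewrite ffunE => /negPf -> /=; rewrite expr0n addr0.
Qed.

Section Pivots.
Variables (F : nat) (M : 'I_F -> bits V) (piv : 'I_F -> option 'I_V).
Hypothesis pivP : forall f,
  if piv f is Some q then M f q /\ forall g : 'I_F, (f < g)%N -> ~~ M g q
  else M f = 0.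

(** The block of the head of the list is run last. Since the pivot row of [f] vanishes in all later
    columns, its pivot qubit has not been touched by the blocks that precede it. *)
Definition prep_circuit (l : seq 'I_F) : circuit R V :=
  foldr (fun f c => c ++ (if piv f is Some q then block q (M f) else [::])) [::] l.

Lemma superpose_support (l : seq 'I_F) q x :
  (forall f, f \in l -> ~~ M f q) -> x q -> superpose R M l x = 0.
Proof.
elim: l x => [|f l IHl] x Ml xq /=; rewrite ffunE.
  by case: eqP xq => // ->; rewrite ffunE.
rewrite ffunE !IHl ?addr0 // => [g gl|g gl|].
- by apply: Ml; rewrite inE gl orbT.
- by apply: Ml; rewrite inE gl orbT.
by rewrite ffunE xq (negPf (Ml f _)) ?inE ?eqxx.
Qed.

Lemma prep_circuitP (l : seq 'I_F) : pairwise (fun f g : 'I_F => (f < g)%N) l ->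
  sqnorm (run_circuit (prep_circuit l)) = 1 /\
  exists2 a : R, 0 < a &
    run_circuit (prep_circuit l) = [ffun x => a%:C * superpose R M l x].
Proof.
elim: l => [_|f l IHl] /=.
  split; first exact: sqnorm_ket0.
  by exists 1 => //; apply/ffunP => x; rewrite [RHS]ffunE mul1r.
move=> /andP[/allP fl /IHl[n1 [a a0 e]]].
rewrite /run_circuit foldl_cat -/(run_circuit (prep_circuit l)).
have := pivP f; case: (piv f) => [q [Mfq Mgq]|Mf0].
  have psi0 y : y q -> run_circuit (prep_circuit l) y = 0.
    move=> yq; rewrite e ffunE (superpose_support (q := q)) ?mulr0 // => g /fl.
    exact: Mgq.
  rewrite run_block // (sqnorm_block Mfq psi0); split => //.
  exists (invsqrt2 * a); first by rewrite mulr_gt0 // invsqrt2_gt0.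
  apply/ffunP => x; rewrite e !ffunE rmorphM /=; ring.
(* A zero column doubles [superpose] while no gate is emitted; the factor [2^-1] compensates. *)
split => //=; exists (2^-1 * a); first by rewrite mulr_gt0 // invr_gt0.
apply/ffunP => x; rewrite e !ffunE Mf0 addr0 rmorphM /= fmorphV rmorph_nat.
by field.
Qed.

End Pivots.

Lemma face_XE F (G : colex V F) f psi : face_X G f psi = shift (face_bits G f) psi.
Proof.
apply/ffunP => x; rewrite !ffunE (bigD1 (x + face_bits G f)) //= [X in _ + X]big1.
  rewrite addr0 big1 ?mul1r // => v _; rewrite !ffunE; case: incident.
    by rewrite mxE bit_eq; case: (x v).
  by rewrite mxE bit_eq addr0 eqxx.
move=> y; rewrite eq_sym => yx.
have /existsP[v xv] : [exists v, (x + face_bits G f) v != y v].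
  apply: contraR yx; rewrite negb_exists => /forallP xy.
  by apply/eqP/ffunP => v; have := xy v; rewrite negbK => /eqP.
rewrite (bigD1 v) //= (_ : _ (bit _) _ = 0) ?mul0r //.
move: xv; rewrite !ffunE; case: incident; rewrite mxE bit_eq.
  by case: (x v); case: (y v).
by rewrite addr0 => /negPf ->.
Qed.

Lemma color_code_unnormalizedE F (G : colex V F) :
  color_code_unnormalized R G = [ffun x => (amplitude R (face_bits G) x)%:C].
Proof.
apply/ffunP => x; rewrite ffunE -superposeE /color_code_unnormalized /superpose.
congr (fun_of_fin _ x); elim: (enum _) => //= f l ->.
by rewrite face_XE.
Qed.

(** The output of the circuit is a positive multiple of the unnormalized color code vector and has
    norm 1, which determines the multiple. *)
Lemma prep_color_code F (G : colex V F) (M : 'I_F -> bits V) (piv : 'I_F -> option 'I_V) :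
  (forall f, if piv f is Some q
    then M f q /\ forall g : 'I_F, (f < g)%N -> ~~ M g q else M f = 0) ->
  amplitude R M =1 amplitude R (face_bits G) ->
  run_circuit (prep_circuit M piv (enum 'I_F)) = color_code_state R G.
Proof.
move=> pivP MB.
have pw : pairwise (fun f g : 'I_F => (f < g)%N) (enum 'I_F).
  rewrite -(pairwise_map val (fun x y : nat => (x < y)%N)) val_enum_ord.
  by rewrite -sorted_pairwise ?iota_ltn_sorted // => ? ? ?; exact: ltn_trans.
have [n1 [a a0 e]] := prep_circuitP pivP pw.
set U := color_code_unnormalized R G.
have eU : run_circuit (prep_circuit M piv (enum 'I_F)) = [ffun x => a%:C * U x].
  by rewrite e; apply/ffunP => x; rewrite !ffunE superposeE MB /U color_code_unnormalizedE ffunE.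
move: n1; rewrite eU sqnormZ => n1.
have n0 : 0 < sqnorm U.
  have : 0 < a ^+ 2 * sqnorm U by rewrite n1.
  by rewrite pmulr_rgt0 // exprn_gt0.
suff -> : a = (Num.sqrt (sqnorm U))^-1 by [].
rewrite -[a]ger0_norm ?ltW // -sqrtr_sqr -sqrtrV ?ltW //; congr Num.sqrt.
by apply: (mulIf (lt0r_neq0 n0)); rewrite n1 mulVf // lt0r_neq0.
Qed.

End Circuit.

(** * Measurement statistics *)

Section Born.
Local Open Scope complex_scope.
Variables (R : realType) (V : nat).
Implicit Types (r : bits V -> R) (x y z : bits V).

Lemma born_ge0 (A : 'I_V -> 'M[R]_2) psi x : 0 <= born A psi x.
Proof. by apply: sumr_ge0 => y _; rewrite addr_ge0 // sqr_ge0. Qed.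

Definition real_projector (A : 'M[R]_2) (b : bool) : 'M[R]_2 :=
  2^-1 *: (1 + (-1) ^+ b *: A).

Lemma sum_bits2 (U : nmodType) (g : 'I_2 -> U) :
  \sum_(i < 2) g i = \sum_(b : bool) g (bit b).
Proof.
rewrite big_bool big_ord_recl big_ord1 /= addrC.
by congr (g _ + g _); apply/val_inj; rewrite /= bitE.
Qed.

Lemma real_projectorK (A : 'M[R]_2) b : A^T = A -> A *m A = 1%:M ->
  (real_projector A b)^T *m real_projector A b = real_projector A b.
Proof.
move=> AT AA; set B := (-1) ^+ b *: A.
have BB : B * B = 1.
  rewrite /B -scalerAl -scalerAr scalerA -expr2 sqrr_sign scale1r; exact: AA.
have -> : (real_projector A b)^T = real_projector A b.
  by rewrite /real_projector; apply/matrixP => i j; rewrite !mxE -[in LHS]AT mxE eq_sym.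
rewrite -[LHS]/(real_projector A b * real_projector A b) /real_projector -/B.
rewrite -scalerAl -scalerAr scalerA mulrDl !mulrDr BB !mul1r !mulr1 (addrC B) -mulr2n.
by rewrite -scaler_nat scalerA -mulrA mulVf ?pnatr_eq0 // mulr1.
Qed.

Lemma born_real (A : 'I_V -> 'M[R]_2) r x :
  born A [ffun z => (r z)%:C] x
  = \sum_(y : bits V) (\sum_(z : bits V) (\prod_v real_projector (A v) (x v) (bit (y v)) (bit (z v))) * r z) ^+ 2.
Proof.
apply: eq_bigr => y _; rewrite ffunE.
rewrite (_ : \sum_z _ = (\sum_(z : bits V) (\prod_v real_projector (A v) (x v) (bit (y v)) (bit (z v))) * r z)%:C) /=.
  by rewrite expr0n addr0.
rewrite rmorph_sum; apply: eq_bigr => z _.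
by rewrite ffunE rmorphM rmorph_prod; congr (_ * _); apply: eq_bigr => v _; rewrite mxE.
Qed.

(** Both the sum over outcomes and the sum over the intermediate basis factor over the qubits, and
    two copies of a symmetric idempotent merge into one. The weight [g = 1] yields the total
    probability, [g = sign] the expectation of the product of the outcomes. *)
Lemma sum_born (A : 'I_V -> 'M[R]_2) r (g : bool -> R) :
  (forall v, (A v)^T = A v) -> (forall v, A v *m A v = 1%:M) ->
  \sum_(x : bits V) (\prod_v g (x v)) * born A [ffun z => (r z)%:C] x
  = \sum_(z : bits V) \sum_(z' : bits V) r z * r z' *
      \prod_v \sum_b g b * real_projector (A v) b (bit (z v)) (bit (z' v)).
Proof.
move=> AT AA; pose P v b (c d : bool) := real_projector (A v) b (bit c) (bit d).
have PP v b c d : \sum_a P v b a c * P v b a d = P v b c d.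
  rewrite /P -[in RHS](real_projectorK b (AT v) (AA v)) mxE sum_bits2.
  by apply: eq_bigr => a _; congr (_ * _); rewrite [RHS]mxE.
have bornE x : born A [ffun z => (r z)%:C] x =
    \sum_(z : bits V) \sum_(z' : bits V) r z * r z' * \prod_v P v (x v) (z v) (z' v).
  rewrite born_real; under eq_bigr do rewrite expr2 big_distrlr /=.
  rewrite exchange_big; apply: eq_bigr => z _; rewrite exchange_big; apply: eq_bigr => z' _ /=.
  transitivity (r z * r z' * \sum_(y : bits V) \prod_v (P v (x v) (y v) (z v) * P v (x v) (y v) (z' v))).
    rewrite mulr_sumr; apply: eq_bigr => y _; rewrite big_split /= /P; ring.
  congr (_ * _); rewrite -(bigA_distr_bigA (fun v a => P v (x v) a (z v) * P v (x v) a (z' v))).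
  by apply: eq_bigr => v _; rewrite PP.
under eq_bigr do rewrite bornE mulr_sumr.
rewrite exchange_big; apply: eq_bigr => z _.
under eq_bigr do rewrite mulr_sumr.
rewrite exchange_big; apply: eq_bigr => z' _ /=.
rewrite (bigA_distr_bigA (fun v b => g b * P v b (z v) (z' v))) mulr_sumr.
by apply: eq_bigr => x _; rewrite big_split /=; ring.
Qed.

Lemma sum_real_projector (A : 'M[R]_2) b c :
  \sum_a real_projector A a (bit b) (bit c) = (b == c)%:R.
Proof.
by rewrite big_bool !mxE bit_eq /= expr0 expr1; case: (b == c) => /=; field.
Qed.

Lemma sum_sign_projector (A : 'M[R]_2) b c :
  \sum_a sign R a * real_projector A a (bit b) (bit c) = A (bit b) (bit c).
Proof.
by rewrite big_bool /sign !mxE bit_eq /= expr0 expr1; case: (b == c) => /=; field.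
Qed.

Lemma prod_eqE x y : \prod_v ((x v == y v)%:R : R) = (x == y)%:R.
Proof.
case: eqP => [->|/eqP xy]; first by rewrite big1 // => v _; rewrite eqxx.
have /existsP[v xv] : [exists v, x v != y v].
  apply: contraR xy; rewrite negb_exists => /forallP xy.
  by apply/eqP/ffunP => v; have := xy v; rewrite negbK => /eqP.
by rewrite (bigD1 v) //= (negPf xv) mul0r.
Qed.

Lemma sum_born1 (A : 'I_V -> 'M[R]_2) r :
  (forall v, (A v)^T = A v) -> (forall v, A v *m A v = 1%:M) ->
  \sum_(x : bits V) born A [ffun z => (r z)%:C] x = \sum_(z : bits V) r z ^+ 2.
Proof.
move=> AT AA; have := sum_born r (fun=> 1) AT AA.
rewrite (eq_bigr (fun x => born A [ffun z => (r z)%:C] x)) => [->|x _]; last first.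
  by rewrite big1 ?mul1r.
apply: eq_bigr => z _; rewrite (bigD1 z) //= [X in _ + X]big1 ?addr0 => [|z' zz'].
  rewrite big1 ?mulr1 // => v _; under eq_bigr do rewrite mul1r.
  by rewrite sum_real_projector eqxx.
rewrite (eq_bigr (fun v => (z v == z' v)%:R)) => [|v _]; last first.
  by under eq_bigr do rewrite mul1r; rewrite sum_real_projector.
by rewrite prod_eqE eq_sym (negPf zz') mulr0.
Qed.

Lemma sum_born_sign (A : 'I_V -> 'M[R]_2) r :
  (forall v, (A v)^T = A v) -> (forall v, A v *m A v = 1%:M) ->
  \sum_(x : bits V) (\prod_v sign R (x v)) * born A [ffun z => (r z)%:C] x
  = \sum_(z : bits V) \sum_(z' : bits V) r z * r z' * \prod_v A v (bit (z v)) (bit (z' v)).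
Proof.
move=> AT AA; rewrite sum_born //; apply: eq_bigr => z _; apply: eq_bigr => z' _.
by congr (_ * _); apply: eq_bigr => v _; rewrite sum_sign_projector.
Qed.

End Born.

(** * The expected product of outcomes as a partition function *)

Section Partition.
Local Open Scope complex_scope.
Variables (R : realType) (V F : nat) (G : colex V F) (beta : R) (J : 'I_V -> R).
Local Notation w := (weight beta J).
Local Notation A := (observable beta J).
Local Notation B := (combine (face_bits G)).
Local Notation amp := (amplitude R (face_bits G)).

Lemma signD (a b : bool) : sign R (a + b) = sign R a * sign R b.
Proof. by rewrite /sign signr_addb. Qed.

Lemma sign_sum (I : Type) (r : seq I) (P : pred I) (g : I -> bool) :
  sign R (\sum_(i <- r | P i) g i) = \prod_(i <- r | P i) sign R (g i).
Proof. by rewrite (big_morph (sign R) signD (erefl : sign R 0 = 1)). Qed.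

Lemma weight_gt0 a : 0 < w a.
Proof. by rewrite sqrtr_gt0 addr_gt0 // expR_gt0. Qed.

Lemma partition_functionE : partition_function G beta J =
  \sum_s \prod_v expR (beta * J v * sign R (B s v)).
Proof.
apply: eq_bigr => s _; rewrite -expR_sum; congr expR.
rewrite /energy mulrNN mulr_sumr; apply: eq_bigr => v _; rewrite mulrA; congr (_ * _).
rewrite -sign_sum; congr (sign R _); rewrite ffunE big_mkcond; apply: eq_bigr => f _.
by rewrite ffunE; case: incident.
Qed.

(** The sign is negative only at [b = c = 1]. Writing its exponent through [b] and [b + c]
    separates, for [c = b + t], a part linear in [b] from a part bilinear in [b] and [t]. *)
Lemma observableE v (b c : bool) : A v (bit b) (bit c) =
  (w v)^-1 * (expR (beta * J v * sign R (b + c)) * sign R (b * (1 + (b + c)))).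
Proof.
rewrite /observable !mxE bit_eq bitE /sign.
by case: b; case: c; rewrite /= ?expr0 ?expr1 ?mulr1 ?mulrN1 ?mul1r ?mulN1r ?mulrN ?mulr1.
Qed.

Lemma sum_amplitude_observable :
  \sum_(z : bits V) \sum_(z' : bits V) amp z * amp z' * \prod_v A v (bit (z v)) (bit (z' v))
  = 2 ^+ F * (\prod_v w v)^-1 * partition_function G beta J.
Proof.
have -> : \sum_(z : bits V) \sum_(z' : bits V) amp z * amp z' * \prod_v A v (bit (z v)) (bit (z' v)) =
    \sum_(z : bits V) amp z * \sum_(z' : bits V) amp z' * \prod_v A v (bit (z v)) (bit (z' v)).
  by apply: eq_bigr => z _; rewrite mulr_sumr; apply: eq_bigr => z' _; rewrite mulrA.
rewrite (sum_amplitude (face_bits G) (fun z => \sum_(z' : bits V) amp z' * \prod_v A v (bit (z v)) (bit (z' v)))).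
have H s : \sum_(z' : bits V) amp z' * \prod_v A v (bit (B s v)) (bit (z' v)) =
    (\prod_v w v)^-1 * partition_function G beta J.
  rewrite (sum_amplitude (face_bits G) (fun z' => \prod_v A v (bit (B s v)) (bit (z' v)))).
  (* Translating by [s] makes the inner sum independent of [s]; the outer sum then only contributes
     the factor [2 ^+ F]. *)
  rewrite (reindex_inj (addrI s)) /= partition_functionE mulr_sumr; apply: eq_bigr => t _.
  have vE v : A v (bit (B s v)) (bit (B (s + t) v)) =
      (w v)^-1 * (expR (beta * J v * sign R (B t v)) * sign R (B s v + B s v * B t v)).
    have addE (x y : bits V) : (x + y) v = x v + y v by rewrite ffunE.
    have e : B s v + B (s + t) v = B t v by rewrite combineD addE addrA addbool add0r.
    by rewrite observableE e mulrDr mulr1.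
  under eq_bigr do rewrite vE; rewrite !big_split /= prodfV -sign_sum big_split /=.
  (* The linear part of the exponent vanishes by even weight, the bilinear part by orthogonality. *)
  by rewrite sum_combine sum_combine_mul addr0 /sign expr0 mulr1.
rewrite (eq_bigr _ (fun s _ => H s)).
by rewrite sumr_const card_ffun card_bool card_ord -(mulr_natl _ (2 ^ F)%N) natrX mulrA.
Qed.

(** This counts the pairs of selections with equal codewords; each fiber is a translate of the
    kernel, which has four elements. *)
Lemma sum_amplitude_sqr : \sum_(z : bits V) amp z ^+ 2 = 2 ^+ F * 4.
Proof.
under eq_bigr do rewrite expr2; rewrite sum_amplitude.
have H s : amp (B s) = 4.
  rewrite /amplitude (reindex_inj (addrI s)) /=.
  have -> : 4 = #|[set t | B t == 0]|%:R :> R by rewrite card_ker.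
  rewrite -sum1dep_card natr_sum [RHS]big_mkcond /=; apply: eq_bigr => t _.
  by rewrite combineD -subr_eq0 addrC addKr; case: eqP.
rewrite (eq_bigr _ (fun s _ => H s)).
by rewrite sumr_const card_ffun card_bool card_ord -(mulr_natl _ (2 ^ F)%N) natrX.
Qed.

Definition rho z : R := (Num.sqrt (2 ^+ F * 4))^-1 * amp z.

Lemma color_code_stateE : color_code_state R G = [ffun z => (rho z)%:C].
Proof.
apply/ffunP => z; rewrite !ffunE color_code_unnormalizedE ffunE /rho rmorphM.
congr (((Num.sqrt _)^-1)%:C * _); rewrite -sum_amplitude_sqr; apply: eq_bigr => y _.
by rewrite ffunE /= expr0n addr0.
Qed.

Lemma sum_born_color_code : \sum_(x : bits V) born A (color_code_state R G) x = 1.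
Proof.
rewrite color_code_stateE sum_born1; first last.
- by move=> v; exact: observableK.
- by move=> v; exact: observable_sym.
under eq_bigr do rewrite exprMn; rewrite -mulr_sumr sum_amplitude_sqr.
by rewrite exprVn sqr_sqrtr ?mulVf // ?mulf_neq0 ?expf_neq0 ?mulr_ge0 ?exprn_ge0 ?pnatr_eq0 ?ler0n.
Qed.

Lemma mean_born_color_code :
  \sum_(x : bits V) (\prod_v sign R (x v)) * born A (color_code_state R G) x
  = partition_function G beta J / (4 * \prod_v w v).
Proof.
rewrite color_code_stateE sum_born_sign; first last.
- by move=> v; exact: observableK.
- by move=> v; exact: observable_sym.
transitivity ((Num.sqrt (2 ^+ F * 4)) ^- 2 *
  \sum_(z : bits V) \sum_(z' : bits V) amp z * amp z' * \prod_v A v (bit (z v)) (bit (z' v)) : R).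
  rewrite mulr_sumr; apply: eq_bigr => z _; rewrite mulr_sumr; apply: eq_bigr => z' _.
  rewrite /rho -exprVn; ring.
rewrite sum_amplitude_observable sqr_sqrtr ?mulr_ge0 ?exprn_ge0 ?ler0n //.
have w0 : \prod_v w v != 0 by apply/prodf_neq0 => v _; rewrite lt0r_neq0 // weight_gt0.
field; rewrite w0 /=; by rewrite ?expf_neq0 ?pnatr_eq0.
Qed.

End Partition.

(** * Concentration *)

Section Concentration.
Variable R : realType.

(** From [1 - y <= expR (- y)] one gets [expR y <= 1 / (1 - y)], and multiplying the right-hand side
    by [1 - y] gives [1 + y ^+ 2 * (1 - 2 * y)], which is at least 1. *)
Lemma expR_le_quadratic (y : R) : y <= 2^-1 -> expR y <= 1 + y + 2 * y ^+ 2.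
Proof.
move=> y2; have h1 : 1 - y <= expR (- y) by have := expR_ge1Dx (- y).
have e0 := expR_gt0 y; have := expRxMexpNx_1 y.
move: (expR y) (expR (- y)) e0 h1 => a b a0 h1 ab.
have h2 : a * (1 - y) <= 1 by rewrite -[leRHS]ab ler_wpM2l // ltW.
have y1 : 0 < 1 - y by lra.
rewrite -(ler_pM2r y1); apply: (le_trans h2).
have : 0 <= y ^+ 2 * (1 - 2 * y) by rewrite mulr_ge0 ?sqr_ge0 //; lra.
by lra.
Qed.

Variables (T : finType) (P : T -> R).
Hypotheses (P0 : forall x, 0 <= P x) (P1 : \sum_x P x = 1).
Implicit Type g : T -> R.

Definition iid (K : nat) (E : pred {ffun 'I_K -> T}) : R :=
  \sum_(w | E w) \prod_k P (w k).

(** The deviation from the mean is at most 2, so [t <= 4^-1] brings the exponent into the range of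
    the quadratic bound. The linear term averages to 0 and the variance is at most 1. *)
Lemma mgf_le g (t : R) : (forall x, `|g x| <= 1) -> 0 <= t <= 4^-1 ->
  \sum_x P x * expR (t * (g x - \sum_y P y * g y)) <= expR (2 * t ^+ 2).
Proof.
move=> g1 /andP[t0 t4]; set mu := \sum_y P y * g y.
have mu1 : `|mu| <= 1.
  rewrite (le_trans (ler_norm_sum _ _ _)) // -P1 ler_sum // => x _.
  by rewrite normrM (ger0_norm (P0 x)) ler_piMr.
have Eg2 : \sum_x P x * g x ^+ 2 <= 1.
  rewrite -P1 ler_sum // => x _; rewrite ler_piMr // -[g x ^+ 2]ger0_norm ?sqr_ge0 //.
  by rewrite normrX expr_le1.
have H x : P x * expR (t * (g x - mu)) <=
    P x * (1 - t * mu + 2 * t ^+ 2 * mu ^+ 2) + (P x * g x) * (t - 4 * t ^+ 2 * mu)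
      + 2 * t ^+ 2 * (P x * g x ^+ 2).
  have le2 : t * (g x - mu) <= 2^-1.
    have := g1 x; move: mu1; rewrite !ler_norml => /andP[m1 m2] /andP[x1 x2].
    have gm : 0 <= 2 - (g x - mu) by lra.
    have := mulr_ge0 t0 gm; lra.
  apply: (le_trans (ler_wpM2l (P0 x) (expR_le_quadratic le2))).
  by lra.
apply: (le_trans (ler_sum _ (fun x _ => H x))).
rewrite !big_split /= -!mulr_suml -mulr_sumr P1 -/mu mul1r.
apply: (le_trans _ (expR_ge1Dx (2 * t ^+ 2))).
have : 0 <= t ^+ 2 * (1 - \sum_x P x * g x ^+ 2) by rewrite mulr_ge0 ?sqr_ge0 // subr_ge0.
have : 0 <= t ^+ 2 * mu ^+ 2 by rewrite mulr_ge0 // sqr_ge0.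
move: (\sum_x P x * g x ^+ 2) => S; nra.
Qed.

Lemma upper_tail g K (eps : R) : (forall x, `|g x| <= 1) -> 0 <= eps <= 1 ->
  iid (fun w : {ffun 'I_K -> T} =>
    K%:R * eps <= \sum_k (g (w k) - \sum_x P x * g x)) <= expR (- (K%:R * eps ^+ 2 / 8)).
Proof.
(* The Chernoff parameter [eps / 4] minimizes [2 * t ^+ 2 - t * eps], with value [- eps ^+ 2 / 8];
   [eps <= 1] keeps it in the range of [mgf_le]. *)
move=> g1 /andP[e0 e1]; set mu := \sum_x P x * g x; pose t := eps / 4.
have tle : 0 <= t <= 4^-1 by rewrite /t; apply/andP; split; lra.
pose h (w : {ffun 'I_K -> T}) := \sum_k (g (w k) - mu).
apply: (@le_trans _ _ (\sum_(w : {ffun 'I_K -> T})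
    (\prod_k P (w k)) * expR (t * (h w - K%:R * eps)))).
  rewrite /iid big_mkcond ler_sum // => w _.
  have p0 : 0 <= \prod_k P (w k) by apply: prodr_ge0.
  case: ifP => hw; last by rewrite mulr_ge0 // expR_ge0.
  by rewrite ler_peMr // -[leLHS]expR0 ler_expR mulr_ge0 ?subr_ge0 //; case/andP: tle.
have -> : \sum_(w : {ffun 'I_K -> T}) (\prod_k P (w k)) * expR (t * (h w - K%:R * eps))
  = expR (- (t * K%:R * eps)) * (\sum_x P x * expR (t * (g x - mu))) ^+ K.
  rewrite -[X in _ ^+ X]card_ord -prodr_const.
  rewrite (bigA_distr_bigA (fun _ x => P x * expR (t * (g x - mu)))) mulr_sumr.
  apply: eq_bigr => w _; rewrite big_split /= -expR_sum mulrCA -expRD; congr (_ * expR _).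
  by rewrite -mulr_sumr mulrBr mulrA addrC.
apply: (@le_trans _ _ (expR (- (t * K%:R * eps)) * expR (2 * t ^+ 2) ^+ K)).
  rewrite ler_wpM2l ?expR_ge0 // lerXn2r ?nnegrE ?expR_ge0 //; last exact: mgf_le.
  by apply: sumr_ge0 => x _; rewrite mulr_ge0 // expR_ge0.
rewrite -expRM_natl -expRD ler_expR /t; lra.
Qed.

Lemma iid_le K (E E' : pred {ffun 'I_K -> T}) : (forall w, E w -> E' w) -> iid E <= iid E'.
Proof.
move=> EE'; rewrite /iid big_mkcond [leRHS]big_mkcond ler_sum // => w _.
have p0 : 0 <= \prod_k P (w k) by apply: prodr_ge0.
by case: ifP => [/EE' ->|_] //; case: ifP.
Qed.

Lemma iid1 K : iid (fun _ : {ffun 'I_K -> T} => true) = 1.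
Proof.
by rewrite /iid -(bigA_distr_bigA (fun (_ : 'I_K) x => P x)) big1.
Qed.

Lemma hoeffding g K (eps : R) :
  (forall x, `|g x| <= 1) -> 0 <= eps <= 1 -> (0 < K)%N ->
  1 - 2 * expR (- (K%:R * eps ^+ 2 / 8)) <=
  iid (fun w : {ffun 'I_K -> T} =>
    `|(\sum_k g (w k)) / K%:R - \sum_x P x * g x| <= eps).
Proof.
move=> g1 e01 K0; set mu := \sum_x P x * g x.
have up := @upper_tail g K eps g1 e01.
have dn := @upper_tail (fun x => - g x) K eps _ e01.
have {}dn := dn (fun x => eq_ind_r (fun z => z <= 1) (g1 x) (normrN (g x))).
set E := (X in _ <= iid X).
set E1 := (X in iid X) in up; set E2 := (X in iid X) in dn.
(* Union bound: each sample sequence is accurate or falls into the upper tail of [g] or of [- g]. *)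
have : iid (fun _ : {ffun 'I_K -> T} => true) <= iid E + (iid E1 + iid E2).
  rewrite /iid !(big_mkcond E) !(big_mkcond E1) !(big_mkcond E2) -!big_split ler_sum //= => w _.
  have p0 : 0 <= \prod_k P (w k) by apply: prodr_ge0.
  have K0' : 0 < K%:R :> R by rewrite ltr0n.
  have eS : \sum_k (g (w k) - mu) = \sum_k g (w k) - K%:R * mu.
    by rewrite sumrB sumr_const card_ord mulr_natl.
  have eS' : \sum_k (- g (w k) - \sum_x P x * - g x) = - (\sum_k g (w k) - K%:R * mu).
    rewrite -eS -[RHS]sumrN; apply: eq_bigr => k _.
    by under eq_bigr do rewrite mulrN; rewrite sumrN -/mu opprB opprK addrC.
  have : [|| E w, E1 w | E2 w].
    rewrite /E /E1 /E2 /= eS eS'.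
    have -> : (\sum_k g (w k)) / K%:R - mu = (\sum_k g (w k) - K%:R * mu) / K%:R.
      by field; rewrite lt0r_neq0.
    rewrite normrM normfV (gtr0_norm K0') ler_pdivrMr // (mulrC eps).
    move: (_ - _) => d; case: (lerP 0 d) => [d0|/ltW d0].
      by rewrite ger0_norm //; case: (lerP d (K%:R * eps)) => //= /ltW ->.
    by rewrite ler0_norm //; case: (lerP (- d) (K%:R * eps)) => //= /ltW ->; rewrite orbT.
  by case: (E w); case: (E1 w); case: (E2 w) => //= _; rewrite ?addr0 ?add0r ?lerDl ?lerDr ?addr_ge0.
rewrite iid1; lra.
Qed.

Lemma hoeffding_samples g K (eps p : R) :
  (forall x, `|g x| <= 1) -> 0 < eps -> 0 <= p < 1 ->
  (8 / (eps * eps) + 8) * ln (2 / (1 - p)) <= K%:R ->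
  p <= iid (fun w : {ffun 'I_K -> T} =>
    `|(\sum_k g (w k)) / K%:R - \sum_x P x * g x| <= eps).
Proof.
move=> g1 e0 /andP[p0 p1] hK.
have L0 : 0 < ln (2 / (1 - p)).
  by apply: ln_gt0; rewrite ltr_pdivlMr ?subr_gt0 //; lra.
have ee0 : 0 < eps * eps by rewrite mulr_gt0.
have d0 : 0 < 8 / (eps * eps) by rewrite divr_gt0.
have K0 : (0 < K)%N.
  by rewrite -(ltr0n R); apply: lt_le_trans hK; rewrite mulr_gt0 // addr_gt0.
(* The tail bound requires accuracy at most 1, but [eps] is arbitrary. The additive 8 in the sample
   count covers [eps > 1], and the 2 inside the logarithm pays for the two tails. *)
pose e := Num.min eps 1.
have e1 : 0 < e <= 1 by rewrite lt_min e0 ltr01 ge_min lexx orbT.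
have /andP[e0' e1'] := e1.
have step : p <= 1 - 2 * expR (- (K%:R * e ^+ 2 / 8)).
  suff : expR (- (K%:R * e ^+ 2 / 8)) <= (1 - p) / 2 by lra.
  have -> : (1 - p) / 2 = expR (- ln (2 / (1 - p))).
    by rewrite -lnV ?posrE ?divr_gt0 ?subr_gt0 // lnK ?invf_div // posrE divr_gt0 // subr_gt0.
  rewrite ler_expR lerN2.
  have he : 1 <= (8 / (eps * eps) + 8) * (e ^+ 2 / 8).
    rewrite /e; case: (lerP eps 1) => h.
      have -> : (8 / (eps * eps) + 8) * (eps ^+ 2 / 8) = 1 + eps ^+ 2.
        by field; rewrite lt0r_neq0.
      by rewrite lerDl sqr_ge0.
    rewrite expr1n; lra.
  apply: (@le_trans _ _ ((8 / (eps * eps) + 8) * (e ^+ 2 / 8) * ln (2 / (1 - p)))).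
    by rewrite ler_peMl // ltW.
  rewrite mulrAC -(mulrA K%:R) ler_wpM2r // divr_ge0 ?sqr_ge0 //.
apply: (le_trans step); apply: (@le_trans _ _ _ _ _ (hoeffding g1 _ K0)).
  by rewrite ltW.
by apply: iid_le => w /le_trans; apply; rewrite ge_min lexx.
Qed.

End Concentration.

(** * Running programs *)

Section Programs.
Local Open Scope nat_scope.
Variable R : realType.
Implicit Types (s : Defs.mem R) (c : cmd).

Fixpoint nmods c : seq nat :=
  match c with
  | Skip | RSet _ _ _ _ => [::]
  | NSet arr _ _ _ => [:: arr]
  | Seq c1 c2 | If _ c1 c2 => nmods c1 ++ nmods c2
  | While _ c => nmods c
  end.

Fixpoint rmods c : seq nat :=
  match c with
  | Skip | NSet _ _ _ _ => [::]
  | RSet arr _ _ _ => [:: arr]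
  | Seq c1 c2 | If _ c1 c2 => rmods c1 ++ rmods c2
  | While _ c => rmods c
  end.

(** Whole arrays are the unit of preservation. As each scratch scalar occupies an array of its own,
    what a program leaves intact can be read off its text. *)
Definition frame (ln lr : seq nat) s s' : Prop :=
  (forall a, a \notin ln -> nat_mem s' a = nat_mem s a) /\
  (forall a, a \notin lr -> real_mem s' a = real_mem s a).

Lemma frame_trans ln lr s1 s2 s3 :
  frame ln lr s1 s2 -> frame ln lr s2 s3 -> frame ln lr s1 s3.
Proof. by move=> [n1 r1] [n2 r2]; split=> a al; rewrite ?n2 ?n1 ?r2 ?r1. Qed.

Lemma frame_sub ln lr ln' lr' s s' : {subset ln <= ln'} -> {subset lr <= lr'} ->
  frame ln lr s s' -> frame ln' lr' s s'.
Proof.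
move=> sn sr [n r]; split=> a al; [apply: n|apply: r].
  by apply: contra al; exact: sn.
by apply: contra al; exact: sr.
Qed.

Lemma upd_out (T : Type) (m : nat -> nat -> nat -> T) arr i j x a :
  a \notin [:: arr] -> upd m arr i j x a = m a.
Proof.
rewrite inE => /negPf e; rewrite /upd.
have -> : (a == arr) = false by [].
by [].
Qed.

Lemma exec_frame c s s' t : exec c s s' t -> frame (nmods c) (rmods c) s s'.
Proof.
elim=> {c s s' t} //=.
- by move=> s arr i j e; split=> // a /= al; rewrite upd_out.
- by move=> s arr i j e; split=> // a /= al; rewrite upd_out.
- move=> c1 c2 s s1 s2 t1 t2 _ h1 _ h2; apply: frame_trans.
    by apply: frame_sub h1 => x; rewrite mem_cat => ->.
  by apply: frame_sub h2 => x; rewrite mem_cat orbC => ->.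
- move=> b c1 c2 s s' t _; case: ifP => _; apply: frame_sub => x;
    by rewrite mem_cat => ->; rewrite ?orbT.
- by move=> b c s s1 s2 t1 t2 _ _ h1 _ h2; exact: frame_trans h1 h2.
Qed.

(** A total correctness judgement with a time bound; the frame is part of it, so that later steps
    can recover unmodified inputs. *)
Definition runs_to c s (Q : Defs.mem R -> Prop) (T : nat) : Prop :=
  exists s' t, [/\ exec c s s' t, Q s', frame (nmods c) (rmods c) s s' & t <= T].

Lemma rt_conseq c s (Q Q' : Defs.mem R -> Prop) T T' :
  runs_to c s Q T -> (forall s', Q s' -> frame (nmods c) (rmods c) s s' -> Q' s') ->
  T <= T' -> runs_to c s Q' T'.
Proof.
move=> [s' [t [e q f l]]] QQ lT; exists s', t; split=> //; first exact: QQ.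
exact: leq_trans lT.
Qed.

Lemma rt_seq c1 c2 s (Q1 Q : Defs.mem R -> Prop) T1 T2 T :
  runs_to c1 s Q1 T1 ->
  (forall s1, Q1 s1 -> frame (nmods c1) (rmods c1) s s1 -> runs_to c2 s1 Q T2) ->
  T1 + T2 <= T -> runs_to (Seq c1 c2) s Q T.
Proof.
move=> [s1 [t1 [e1 q1 f1 l1]]] H lT; have [s2 [t2 [e2 q2 f2 l2]]] := H s1 q1 f1.
have e : exec (Seq c1 c2) s s2 (t1 + t2) by apply: ExecSeq e1 e2.
by exists s2, (t1 + t2); split=> //; [exact: exec_frame e | lia].
Qed.

Lemma rt_if b c1 c2 s (Q : Defs.mem R -> Prop) T0 T :
  (beval s b -> runs_to c1 s Q T0) -> (~~ beval s b -> runs_to c2 s Q T0) ->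
  bcost b + T0 <= T -> runs_to (If b c1 c2) s Q T.
Proof.
move=> H1 H2 lT.
have [s' [t [e q f l]]] : runs_to (if beval s b then c1 else c2) s Q T0.
  by case: ifP => h; [exact: H1 | apply: H2; rewrite h].
have e' := ExecIf e.
by exists s', (bcost b + t); split=> //; [exact: exec_frame e' | lia].
Qed.

Fixpoint loopfree c : bool :=
  match c with
  | Skip | RSet _ _ _ _ | NSet _ _ _ _ => true
  | Seq c1 c2 | If _ c1 c2 => loopfree c1 && loopfree c2
  | While _ _ => false
  end.

(** Straight-line evaluation, which reduces such code to computation; the value at [While] is a
    dummy that [loopfree] excludes. *)
Fixpoint step c s : Defs.mem R :=
  match c with
  | NSet arr i j e =>
    Defs.Mem (upd (nat_mem s) arr (neval s i) (neval s j) (neval s e)) (real_mem s)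
  | RSet arr i j e =>
    Defs.Mem (nat_mem s) (upd (real_mem s) arr (neval s i) (neval s j) (reval s e))
  | Seq c1 c2 => step c2 (step c1 s)
  | If b c1 c2 => if beval s b then step c1 s else step c2 s
  | Skip | While _ _ => s
  end.

Fixpoint maxcost c : nat :=
  match c with
  | Skip => 1
  | NSet _ i j e => (ncost i + ncost j + ncost e).+1
  | RSet _ i j e => (ncost i + ncost j + rcost e).+1
  | Seq c1 c2 => maxcost c1 + maxcost c2
  | If b c1 c2 => bcost b + maxn (maxcost c1) (maxcost c2)
  | While _ _ => 0
  end.

Lemma step_exec c s : loopfree c ->
  exists2 t, exec c s (step c s) t & t <= maxcost c.
Proof.
elim: c s => //=.
- by move=> s _; exists 1 => //; exact: ExecSkip.
- by move=> arr i j e s _; exists (ncost i + ncost j + ncost e).+1 => //; exact: ExecNSet.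
- by move=> arr i j e s _; exists (ncost i + ncost j + rcost e).+1 => //; exact: ExecRSet.
- move=> c1 IH1 c2 IH2 s /andP[l1 l2].
  have [t1 e1 le1] := IH1 s l1; have [t2 e2 le2] := IH2 (step c1 s) l2.
  by exists (t1 + t2); [exact: ExecSeq e1 e2 | exact: leq_add].
- move=> b c1 IH1 c2 IH2 s /andP[l1 l2].
  have [t1 e1 le1] := IH1 s l1; have [t2 e2 le2] := IH2 s l2.
  case: ifP => h.
    by exists (bcost b + t1); [apply: ExecIf; rewrite h | rewrite leq_add2l leq_max le1].
  by exists (bcost b + t2); [apply: ExecIf; rewrite h | rewrite leq_add2l leq_max le2 orbT].
Qed.

Lemma rt_step c s (Q : Defs.mem R -> Prop) T :
  loopfree c -> Q (step c s) -> maxcost c <= T -> runs_to c s Q T.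
Proof.
move=> lc q lT; have [t e l] := step_exec s lc.
by exists (step c s), t; split=> //; [exact: exec_frame e | exact: leq_trans lT].
Qed.

Definition var (a : nat) : nexp := NGet a (NConst 0) (NConst 0).

Definition assign (a : nat) (e : nexp) : cmd := NSet a (NConst 0) (NConst 0) e.

Definition cell (a j : nat) : nexp := NGet a (NConst 0) (NConst j).

Definition input_size (j : nat) : nexp := cell 0 j.

Definition For (v a j : nat) (body : cmd) : cmd :=
  Seq (assign v (NConst 0))
    (While (BNot (BNatLe (cell a j) (var v)))
       (Seq body (assign v (NAdd (var v) (NConst 1))))).

Definition setv s v k : Defs.mem R := Defs.Mem (upd (nat_mem s) v 0 0 k) (real_mem s).

Lemma updE (T : Type) (m : nat -> nat -> nat -> T) arr i j x : upd m arr i j x arr i j = x.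
Proof. by rewrite /upd !eqxx. Qed.

(** The bound is re-read from memory in every turn, hence the condition that the body leaves array
    [a] alone. A turn adds 8 operations for the guard and 8 for the increment; the 12 are 4 for the
    initialization and 8 for the last, failing guard. *)
Lemma rt_for v a j body s0 n (I : nat -> Defs.mem R -> Prop) Tb T :
  v != a -> a \notin nmods body -> v \notin nmods body ->
  nat_mem s0 a 0 j = n -> I 0 (setv s0 v 0) ->
  (forall k s, k < n -> frame (v :: nmods body) (rmods body) s0 s ->
     nat_mem s v 0 0 = k -> I k s ->
     runs_to body s (fun s' => I k.+1 (setv s' v k.+1)) Tb) ->
  n * (Tb + 16) + 12 <= T -> runs_to (For v a j body) s0 (I n) T.
Proof.
move=> v0 nb0 nbv hn I0 Hb lT.
pose b := BNot (BNatLe (cell a j) (var v)).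
pose w := While b (Seq body (assign v (NAdd (var v) (NConst 1)))).
have main d : forall k s, k + d = n -> frame (v :: nmods body) (rmods body) s0 s ->
    nat_mem s v 0 0 = k -> I k s ->
    exists s' t, [/\ exec w s s' t, I n s' & t <= d * (Tb + 16) + 8].
  elim: d => [|d IHd] k s kd fs sv Ik.
    have hs : nat_mem s a 0 j = n.
      by rewrite fs.1 // inE negb_or eq_sym v0.
    exists s, 8; split; rewrite ?muln0 //; last by rewrite -kd addn0.
    by apply: (@ExecWhileFalse R b); rewrite /= hs sv negbK; lia.
  have hs : nat_mem s a 0 j = n.
    by rewrite fs.1 // inE negb_or eq_sym v0.
  have kn : k < n by lia.
  have [s1 [t1 [e1 q1 f1 l1]]] := Hb k s kn fs sv Ik.
  have s1v : nat_mem s1 v 0 0 = k by rewrite f1.1.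
  have e2 := ExecNSet s1 v (NConst 0) (NConst 0) (NAdd (var v) (NConst 1)).
  move: e2; rewrite /= s1v addn1 -/(setv s1 v k.+1) => e2.
  have f2 : frame (v :: nmods body) (rmods body) s0 (setv s1 v k.+1).
    apply: frame_trans fs _; apply: (@frame_trans _ _ _ s1).
      by apply: frame_sub f1 => // x; rewrite inE orbC => ->.
    by split=> // a'; rewrite inE negb_or => /andP[av _] /=; rewrite upd_out // inE.
  have [||s' [t [e3 q3 l3]]] := IHd k.+1 _ _ f2 _ q1; [lia | by rewrite /= updE |].
  exists s', (bcost b + (t1 + 8) + t); split=> //; last by rewrite /=; lia.
  apply: (@ExecWhileTrue R b _ s _ s'); last exact: e3.
    by rewrite /= hs sv -ltnNge.
  exact: ExecSeq e1 e2.
have f0 : frame (v :: nmods body) (rmods body) s0 (setv s0 v 0).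
  by split=> // a'; rewrite inE negb_or => /andP[av _] /=; rewrite upd_out // inE.
have [||s' [t [e q l]]] := main n 0 (setv s0 v 0) _ f0 _ I0; [lia | by rewrite /= updE |].
have e' : exec (For v a j body) s0 s' (4 + t).
  by apply: ExecSeq e; exact: (ExecNSet s0 v (NConst 0) (NConst 0) (NConst 0)).
by exists s', (4 + t); split=> //; [exact: exec_frame e' | lia].
Qed.

End Programs.

(** * Elimination *)

Section Elimination.
Local Open Scope nat_scope.

Definition columns (V F : nat) (m : nat -> nat -> nat) (f : 'I_F) : bits V :=
  [ffun v : 'I_V => 0 < m v f].

Definition pivots (V F : nat) (m : nat -> nat -> nat) (pv : nat -> nat) (k : nat) : Prop :=
  forall f, f < k ->
    [/\ pv f < V, 0 < m (pv f) f & forall g, f < g < F -> m (pv f) g = 0]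
    \/ (pv f = V /\ forall v, v < V -> m v f = 0).

(** On entries 0 and 1 this is exclusive or. With the number of rows already processed in place of
    [V] it is the loop invariant of [add_columnP]. *)
Definition add_col (V : nat) (m : nat -> nat -> nat) (f g i j : nat) : nat :=
  if (j == g) && (i < V) then (m i g - m i f) + (m i f - m i g) else m i j.

(* Row V, which lies outside of the matrix, stays zero: it is the row that is
   read when a column has no pivot. *)
Definition column_equivalent (R : realType) (V F : nat) (M : 'I_F -> bits V)
    (m : nat -> nat -> nat) : Prop :=
  [/\ forall i j, m i j <= 1, forall j, m V j = 0
    & amplitude R (@columns V F m) =1 amplitude R M].

Lemma column_equivalent_add_col (R : realType) V F (M : 'I_F -> bits V) m m' f g :
  f < g -> g < F -> column_equivalent R M m ->
  (forall i j, m' i j = add_col V m f g i j) -> column_equivalent R M m'.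
Proof.
move=> fg gF [m1 mV mM] m'E; split.
- move=> i j; rewrite m'E /add_col; have := m1 i g; have := m1 i f; have := m1 i j.
  by case: ifP => _; lia.
- by move=> j; rewrite m'E /add_col ltnn andbF.
move=> x; rewrite -mM.
have fF := ltn_trans fg gF.
apply: (@amplitude_addcol R V F _ _ (Ordinal fF) (Ordinal gF)).
- by rewrite -val_eqE /= neq_ltn fg.
- move=> h; rewrite -val_eqE /= => /negPf hg; apply/ffunP => v.
  by rewrite !ffunE m'E /add_col hg.
apply/ffunP => v; rewrite !ffunE m'E /add_col eqxx ltn_ord /=.
have := m1 v g; have := m1 v f.
by case: (m v f) => [|[|]] //; case: (m v g) => [|[|]].
Qed.

(** The pivot rows of the columns before [f] are already zero in both columns [f] and [g], so adding
    one to the other leaves them zero. *)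
Lemma pivots_add_col V F m m' pv f g :
  f < g -> g < F -> pivots V F m pv f ->
  (forall i j, m' i j = add_col V m f g i j) -> pivots V F m' pv f.
Proof.
move=> fg gF mP m'E h hf; have hg : (h == g) = false by lia.
case: (mP h hf) => [[h1 h2 h3]|[h1 h2]]; [left|right]; split=> //.
- by rewrite m'E /add_col hg.
- move=> j hj; rewrite m'E /add_col; case: ifP => _; last exact: h3.
  by rewrite !h3 //; lia.
by move=> v vV; rewrite m'E /add_col hg /= h2.
Qed.

(* Scratch memory: the natural array 5 holds the pivots, with V for a column
   without pivot, and 10 to 13 are counters; the real arrays 5 to 8 are scalars. *)
Definition pivot_of (f : nexp) : nexp := NGet 5 f (NConst 0).

Definition find_pivot : cmd :=
  Seq (NSet 5 (var 10) (NConst 0) (input_size 0))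
    (For 11 0 0 (If (BNatLe (NConst 1) (NGet 1 (var 11) (var 10)))
                  (NSet 5 (var 10) (NConst 0) (var 11)) Skip)).

(* x + y mod 2 is computed as (x - y) + (y - x) with truncated subtraction. *)
Definition add_column : cmd :=
  For 11 0 0
    (NSet 1 (var 11) (var 12)
       (NAdd (NSub (NGet 1 (var 11) (var 12)) (NGet 1 (var 11) (var 10)))
             (NSub (NGet 1 (var 11) (var 10)) (NGet 1 (var 11) (var 12))))).

Definition clear_row : cmd :=
  For 12 0 1 (If (BAnd (BNatLe (NAdd (var 10) (NConst 1)) (var 12))
                     (BNatLe (NConst 1) (NGet 1 (pivot_of (var 10)) (var 12))))
               add_column Skip).

Definition eliminate : cmd := For 10 0 1 (Seq find_pivot clear_row).

Variable R : realType.
Implicit Types s : Defs.mem R.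

Lemma find_pivotP s V f : nat_mem s 0 0 0 = V -> nat_mem s 10 0 0 = f ->
  runs_to find_pivot s (fun s' => exists q,
    (forall g, nat_mem s' 5 g 0 = if g == f then q else nat_mem s 5 g 0) /\
    ((q < V /\ 0 < nat_mem s 1 q f) \/
     (q = V /\ forall v, v < V -> nat_mem s 1 v f = 0))) (V * 100 + 100).
Proof.
move=> hV hf; pose s1 := step (NSet 5 (var 10) (NConst 0) (input_size 0)) s.
apply: (@rt_seq _ _ _ _ (fun s' => s' = s1) _ 20 (V * 100 + 12)); [exact: rt_step | | lia].
move=> _ -> _.
pose I k (s' : Defs.mem R) := exists q,
    (forall g, nat_mem s' 5 g 0 = if g == f then q else nat_mem s 5 g 0) /\
    ((q < V /\ 0 < nat_mem s 1 q f) \/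
     (q = V /\ forall v, v < k -> nat_mem s 1 v f = 0)).
apply: (@rt_for _ _ _ _ _ _ V I 60) => //; last lia.
  exists V; split; last by right.
  by move=> g; rewrite /= /upd /= hV hf andbT.
move=> k s' kV fr sk [q [q5 qP]].
have m1 : nat_mem s' 1 = nat_mem s 1 by rewrite fr.1.
have s10 : nat_mem s' 10 0 0 = f by rewrite fr.1.
apply: rt_step => //; rewrite /I /= s10 sk m1; case: ifP => hm.
  exists k; split; last by left.
  by move=> g; rewrite /= /upd /= andbT q5; case: eqP.
exists q; split; first by move=> g; rewrite /= /upd /= q5.
case: qP => [|[-> qP]]; [by left | right; split=> // v]; rewrite ltnS leq_eqVlt.
by case/orP => [/eqP ->|/qP //]; move: hm; case: (nat_mem s 1 k f).
Qed.

Lemma add_columnP s V f g : nat_mem s 0 0 0 = V -> nat_mem s 10 0 0 = f ->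
  nat_mem s 12 0 0 = g -> f != g ->
  runs_to add_column s (fun s' =>
    forall i j, nat_mem s' 1 i j = add_col V (nat_mem s 1) f g i j) (V * 100 + 12).
Proof.
move=> hV hf hg fg.
pose I k (s' : Defs.mem R) := forall i j, nat_mem s' 1 i j = add_col k (nat_mem s 1) f g i j.
apply: (@rt_for _ _ _ _ _ _ V I 80) => //; last lia.
  by move=> i j; rewrite /add_col ltn0 andbF.
move=> k s' kV fr sk Ik.
have s10 : nat_mem s' 10 0 0 = f by rewrite fr.1.
have s12 : nat_mem s' 12 0 0 = g by rewrite fr.1.
apply: rt_step => //; rewrite /I => i j /=; rewrite s10 s12 sk /upd /= !Ik /add_col.
rewrite eqxx ltnn andbF (negPf fg) /=.
rewrite (ltnS i) (leq_eqVlt i); case: (eqVneq i k) => [->|_]; case: (j == g) => //=.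
Qed.

Lemma clear_rowP s V F (M : 'I_F -> bits V) f q :
  nat_mem s 0 0 0 = V -> nat_mem s 0 0 1 = F -> nat_mem s 10 0 0 = f ->
  nat_mem s 5 f 0 = q -> f < F -> column_equivalent R M (nat_mem s 1) ->
  pivots V F (nat_mem s 1) (fun g => nat_mem s 5 g 0) f ->
  ((q < V /\ 0 < nat_mem s 1 q f) \/
     (q = V /\ forall v, v < V -> nat_mem s 1 v f = 0)) ->
  runs_to clear_row s (fun s' => column_equivalent R M (nat_mem s' 1) /\
     pivots V F (nat_mem s' 1) (fun g => nat_mem s 5 g 0) f.+1) (F * (V * 100 + 100) + 12).
Proof.
move=> hV hF hf hq fF eqm piv qP.
pose I k (s' : Defs.mem R) := [/\ column_equivalent R M (nat_mem s' 1),
   pivots V F (nat_mem s' 1) (fun g => nat_mem s 5 g 0) f,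
   (forall i, nat_mem s' 1 i f = nat_mem s 1 i f) &
   (forall g, f < g < k -> nat_mem s' 1 q g = 0)].
apply: (@rt_conseq _ _ _ (I F)); last exact: leqnn.
  apply: (@rt_for _ _ _ _ _ _ F I (V * 100 + 60)) => //; last by lia.
    by split=> // g; rewrite ltn0 andbF.
  move=> k s' kF fr sk [I1 I2 I3 I4].
  have s10 : nat_mem s' 10 0 0 = f by rewrite fr.1.
  have s5 : nat_mem s' 5 = nat_mem s 5 by rewrite fr.1.
  have sV : nat_mem s' 0 0 0 = V by rewrite fr.1.
  apply: (@rt_if _ _ _ _ _ _ (V * 100 + 20)); last by rewrite /=; lia.
    rewrite /= s10 sk s5 hq addn1 => /andP[fk mqk].
    (* A nonzero entry was read in row [q], so [q] is not the marker [V], whose row is zero. *)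
    have qV : q < V.
      by case: qP => [[]//|[qV _]]; move: mqk; rewrite qV; case: I1 => _ ->.
    apply: (@rt_conseq _ _ _ _ _ (V * 100 + 12)); last by lia.
      by apply: (add_columnP sV s10 sk); lia.
    move=> s2 s2E _; split=> /=.
    + exact: column_equivalent_add_col I1 s2E.
    + exact: pivots_add_col I2 s2E.
    + by move=> i; rewrite /upd /= s2E /add_col (_ : (f == k) = false) ?I3 //; lia.
    move=> g /andP[fg]; rewrite /upd /= ltnS leq_eqVlt s2E /add_col => /orP[/eqP ->|gk].
      rewrite eqxx qV /= I3.
      case: qP => [[_ mqf]|[]]; last by move: qV; lia.
      case: I1 => m1 _ _; have := m1 q k; have := m1 q f; rewrite I3.
      by move: mqf mqk; lia.
    have e : (g == k) = false by lia. by rewrite e /= I4 ?fg.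
  rewrite /= s10 sk s5 hq addn1 => hc; apply: rt_step; [by [] | | rewrite /=; lia].
  split=> //= g /andP[fg]; rewrite /upd /= ltnS leq_eqVlt => /orP[/eqP gk|gk]; last by rewrite I4 ?fg.
  by move: hc; rewrite -gk fg /=; case: (nat_mem s' 1 q g).
move=> s' [I1 I2 I3 I4] _; split=> // h; rewrite ltnS leq_eqVlt => /orP[/eqP ->|]; last exact: I2.
rewrite hq; case: qP => [[qV mq]|[qV m0]]; [left|right]; split=> //.
- by rewrite I3.
- by move=> v vV; rewrite I3 m0.
Qed.

Lemma eliminateP s V F (M : 'I_F -> bits V) :
  nat_mem s 0 0 0 = V -> nat_mem s 0 0 1 = F -> column_equivalent R M (nat_mem s 1) ->
  runs_to eliminate s (fun s' => column_equivalent R M (nat_mem s' 1) /\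
     pivots V F (nat_mem s' 1) (fun g => nat_mem s' 5 g 0) F)
   (F * (F * (V * 100 + 100) + V * 100 + 200) + 12).
Proof.
move=> hV hF eqm.
pose I k (s' : Defs.mem R) := column_equivalent R M (nat_mem s' 1) /\
     pivots V F (nat_mem s' 1) (fun g => nat_mem s' 5 g 0) k.
apply: (@rt_for _ _ _ _ _ _ F I (F * (V * 100 + 100) + V * 100 + 120)) => //; last by lia.
move=> k s' kF fr sk [I1 I2].
have sV : nat_mem s' 0 0 0 = V by rewrite fr.1.
have sF : nat_mem s' 0 0 1 = F by rewrite fr.1.
apply: (@rt_seq _ _ _ _ _ _ _ (F * (V * 100 + 100) + 12) _ (find_pivotP sV sk)); last by lia.
move=> s1 [q [q5 qP]] fr1.
have m1 : nat_mem s1 1 = nat_mem s' 1 by rewrite fr1.1.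
apply: rt_conseq (leqnn _).
  apply: (@clear_rowP s1 V F M k q) => //; rewrite ?m1 //.
  - by rewrite fr1.1.
  - by rewrite fr1.1.
  - by rewrite fr1.1.
  - by rewrite q5 eqxx.
  by move=> h hk; have := I2 h hk; rewrite q5 (_ : (h == k) = false) //; lia.
move=> s2 [J1 J2] fr2; split=> //= h hk; have := J2 h hk.
by rewrite /upd /= (fr2.1 5).
Qed.

End Elimination.

(** * Emission of the circuit *)

Definition gate_count : nexp := cell 2 1.

Definition emit_hadamard (q : nexp) : cmd :=
  let h := RDiv (RNat (NConst 1)) (RSqrt (RNat (NConst 2))) in
  Seq (NSet 3 gate_count (NConst 0) (NConst 1))
  (Seq (NSet 3 gate_count (NConst 1) q)
  (Seq (RSet 4 gate_count (NConst 0) h)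
  (Seq (RSet 4 gate_count (NConst 2) h)
  (Seq (RSet 4 gate_count (NConst 4) h)
  (Seq (RSet 4 gate_count (NConst 6) (RSub (RNat (NConst 0)) h))
       (NSet 2 (NConst 0) (NConst 1) (NAdd gate_count (NConst 1)))))))).

(** The real part of entry [(i, j)] sits at index [2 * (4 * i + j)]: 0, 10, 22 and 28 are the ones
    at (0,0), (1,1), (2,3) and (3,2). *)
Definition emit_cnot (q v : nexp) : cmd :=
  let one := RNat (NConst 1) in
  Seq (NSet 3 gate_count (NConst 0) (NConst 2))
  (Seq (NSet 3 gate_count (NConst 1) q)
  (Seq (NSet 3 gate_count (NConst 2) v)
  (Seq (RSet 4 gate_count (NConst 0) one)
  (Seq (RSet 4 gate_count (NConst 10) one)
  (Seq (RSet 4 gate_count (NConst 22) one)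
  (Seq (RSet 4 gate_count (NConst 28) one)
       (NSet 2 (NConst 0) (NConst 1) (NAdd gate_count (NConst 1))))))))).

Definition emit_block : cmd :=
  Seq (emit_hadamard (pivot_of (var 13)))
      (For 11 0 0
        (If (BAnd (BNot (BAnd (BNatLe (var 11) (pivot_of (var 13)))
                              (BNatLe (pivot_of (var 13)) (var 11))))
                  (BNatLe (NConst 1) (NGet 1 (var 11) (var 13))))
            (emit_cnot (pivot_of (var 13)) (var 11)) Skip)).

Definition emit_circuit : cmd :=
  For 10 0 1
    (Seq (assign 13 (NSub (NSub (input_size 1) (NConst 1)) (var 10)))
         (If (BNatLe (NAdd (pivot_of (var 13)) (NConst 1)) (input_size 0))
             emit_block Skip)).

Section Emission.
Local Open Scope nat_scope.
Variables (R : realType) (V : nat).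
Implicit Types (s : Defs.mem R) (c : circuit R V).

(** Only nonzero matrix entries are ever written; the second clause guarantees that the others,
    including all imaginary parts, still have their initial value 0. *)
Definition emitted s c : Prop :=
  stores_circuit s c /\ forall k i, size c <= k -> real_mem s 4 k i = 0%R.

Lemma emitted_rcons s s' c g :
  emitted s c -> gate_ok g -> nat_mem s' 2 0 1 = (size c).+1 ->
  (forall k i, k != size c -> nat_mem s' 3 k i = nat_mem s 3 k i) ->
  (forall k i, k != size c -> real_mem s' 4 k i = real_mem s 4 k i) ->
  stores_gate s' (size c) g -> emitted s' (rcons c g).
Proof.
move=> [[sc okc stc] sz] okg s2 s3 s4 stg; split; last first.
  by move=> k i; rewrite size_rcons => ck; rewrite s4 ?sz ?(ltnW ck) // gtn_eqF.
split; [by rewrite s2 size_rcons | by rewrite all_rcons okg | move=> k g'].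
rewrite -cats1 onth_cat; case: ltnP => kc.
  move=> /(stc k g'); have kn : k != size c by rewrite ltn_eqF.
  have entE j : entry s' k j = entry s k j by rewrite /entry !s4.
  case: g' => [q U|q r U] /=; rewrite !s3 // => -[h1 h2].
    by move=> ->; split=> //; apply/matrixP => i j; rewrite !mxE entE.
  by move=> h3 ->; split=> //; apply/matrixP => i j; rewrite !mxE entE.
case E : (k - size c) => [|d] /=; last by case: d {E}.
by move=> [<-]; have -> : k = size c by lia.
Qed.

(** The expression [q] is evaluated after other cells have been written, so its value is required in
    every memory that agrees on the arrays 5 and 13. *)
Lemma emit_hadamardP s c q (q' : 'I_V) :
  emitted s c ->
  (forall s', nat_mem s' 5 = nat_mem s 5 -> nat_mem s' 13 = nat_mem s 13 ->
    neval s' q = q') -> ncost q <= 10 ->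
  runs_to (emit_hadamard q) s (fun s' =>
    emitted s' (rcons c (Gate1 q' (hadamard R)))) 120.
Proof.
move=> em hq cq; have [[sc _ _] sz] := em.
apply: rt_step => //; last by rewrite /=; lia.
apply: (emitted_rcons em); first exact: hadamard_unitary.
- by rewrite /= /upd /= -sc addn1.
- by move=> k i kc; rewrite /= /upd /= -sc in kc *; rewrite (negPf kc).
- by move=> k i kc; rewrite /= /upd /= -sc in kc *; rewrite (negPf kc).
rewrite /= /upd /= -sc !eqxx /= hq; last by [].
  split=> //; apply/matrixP => i j; rewrite !mxE /entry /= /upd /= eqxx /=.
  have z k : real_mem s 4 (nat_mem s 2 0 1) k = 0%R by rewrite sz // -sc.
  have e1 : (1%:R / Num.sqrt 2%:R = invsqrt2 R)%R by rewrite /invsqrt2 mul1r.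
  by case: i => [[|[|//]] ?]; case: j => [[|[|//]] ?] /=; rewrite z ?e1 ?sub0r.
by [].
Qed.

Lemma emit_cnotP s c q v (q' v' : 'I_V) :
  emitted s c -> q' != v' ->
  (forall s', nat_mem s' 5 = nat_mem s 5 -> nat_mem s' 13 = nat_mem s 13 ->
    neval s' q = q') ->
  (forall s', nat_mem s' 11 = nat_mem s 11 -> neval s' v = v') ->
  ncost q <= 10 -> ncost v <= 10 ->
  runs_to (emit_cnot q v) s (fun s' =>
    emitted s' (rcons c (Gate2 q' v' (cnot R)))) 120.
Proof.
move=> em qv hq hv cq cv; have [[sc _ _] sz] := em.
apply: rt_step => //; last by rewrite /=; lia.
apply: (emitted_rcons em); first by rewrite /= qv cnot_unitary.
- by rewrite /= /upd /= -sc addn1.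
- by move=> k i kc; rewrite /= /upd /= -sc in kc *; rewrite (negPf kc).
- by move=> k i kc; rewrite /= /upd /= -sc in kc *; rewrite (negPf kc).
rewrite /= /upd /= -sc !eqxx /= hq ?hv; [|by []..].
split=> //; apply/matrixP => i j; rewrite !mxE /entry /= /upd /= eqxx /=.
have z k : real_mem s 4 (nat_mem s 2 0 1) k = 0%R by rewrite sz // -sc.
by case: i => [[|[|[|[|//]]]] ?]; case: j => [[|[|[|[|//]]]] ?] /=; rewrite !z.
Qed.

Lemma emit_blockP s c F (f : 'I_F) (q : 'I_V) :
  nat_mem s 0 0 0 = V -> nat_mem s 13 0 0 = f -> nat_mem s 5 f 0 = q ->
  emitted s c ->
  runs_to emit_block s (fun s' =>
    emitted s' (c ++ block R q (@columns V F (nat_mem s 1) f))) (V * 300 + 300).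
Proof.
move=> hV h13 h5 em.
have hq s' : nat_mem s' 5 = nat_mem s 5 -> nat_mem s' 13 = nat_mem s 13 ->
    neval s' (pivot_of (var 13)) = q by move=> e5 e13; rewrite /= e5 e13 h13.
apply: (@rt_seq _ _ _ _ _ _ 120 (V * 300 + 12)); [exact: emit_hadamardP em hq _ | | lia].
move=> s1 em1 fr1.
have h0 : nat_mem s1 0 = nat_mem s 0 by rewrite fr1.1.
have h1 : nat_mem s1 1 = nat_mem s 1 by rewrite fr1.1.
have h5' : nat_mem s1 5 = nat_mem s 5 by rewrite fr1.1.
have h13' : nat_mem s1 13 = nat_mem s 13 by rewrite fr1.1.
pose P (v : 'I_V) := (v != q) && @columns V F (nat_mem s 1) f v.
pose I k s' := emitted s' (rcons c (Gate1 q (hadamard R)) ++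
   [seq Gate2 q v (cnot R) | v <- take k (enum 'I_V) & P v]).
apply: (@rt_conseq _ _ _ (I V)); last exact: leqnn; last first.
  move=> s' + _; rewrite /I take_oversize ?size_enum_ord //.
  by rewrite cat_rcons.
apply: (@rt_for _ _ _ _ _ _ V I 200) => //; last lia.
- by rewrite h0.
- by rewrite /I take0 cats0.
move=> k s' kV fr sk Ik.
have e1 : nat_mem s' 1 = nat_mem s 1 by rewrite fr.1.
have e5 : nat_mem s' 5 = nat_mem s 5 by rewrite fr.1.
have e13 : nat_mem s' 13 = nat_mem s 13 by rewrite fr.1.
pose v : 'I_V := Ordinal kV.
have takeS : take k.+1 (enum 'I_V) = rcons (take k (enum 'I_V)) v.
  by rewrite (take_nth v) ?size_enum_ord // -[X in nth _ _ X]/(val v) nth_ord_enum.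
have PE : beval s' (BAnd (BNot (BAnd (BNatLe (var 11) (pivot_of (var 13)))
                              (BNatLe (pivot_of (var 13)) (var 11))))
                  (BNatLe (NConst 1) (NGet 1 (var 11) (var 13)))) = P v.
  rewrite /= sk e13 h13 e5 h5 e1 /P /columns ffunE -eqn_leq /=.
  by rewrite -val_eqE.
apply: (@rt_if _ _ _ _ _ _ 150) => //; rewrite PE => hP.
  apply: (@rt_conseq _ _ _ _ _ 120); last by [].
    apply: (@emit_cnotP _ _ _ _ q v Ik) => //.
    - by case/andP: hP => hP _; rewrite eq_sym.
    - by move=> s2 h5s h13s; apply: hq; rewrite ?h5s ?h13s ?e5 ?e13.
    by move=> s2 h11 /=; rewrite h11 sk.
  by move=> s2 em2 _; rewrite /I takeS filter_rcons hP map_rcons -rcons_cat.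
by apply: rt_step => //; rewrite /I takeS filter_rcons (negPf hP).
Qed.

Definition pivot_opt (pv : nat -> nat) F (f : 'I_F) : option 'I_V := insub (pv f).

Lemma emit_circuitP s F :
  nat_mem s 0 0 0 = V -> nat_mem s 0 0 1 = F ->
  emitted s [::] ->
  runs_to emit_circuit s (fun s' =>
    emitted s' (prep_circuit R (@columns V F (nat_mem s 1))
      (@pivot_opt (fun f => nat_mem s 5 f 0) F) (enum 'I_F)))
    (F * (V * 300 + 400) + 12).
Proof.
move=> hV hF em.
pose C := prep_circuit R (@columns V F (nat_mem s 1)) (@pivot_opt (fun f => nat_mem s 5 f 0) F).
(* After [k] turns the blocks of the last [k] faces have been emitted, in the order in which
   [prep_circuit] runs them. *)
pose I k s' := emitted s' (C (drop (F - k) (enum 'I_F))).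
apply: (@rt_conseq _ _ _ (I F)); last exact: leqnn; last first.
  by move=> s' + _; rewrite /I subnn drop0.
apply: (@rt_for _ _ _ _ _ _ F I (V * 300 + 350)) => //; last lia.
  by rewrite /I subn0 drop_oversize ?size_enum_ord.
move=> k s' kF fr sk Ik.
have e0 : nat_mem s' 0 = nat_mem s 0 by rewrite fr.1.
have e1 : nat_mem s' 1 = nat_mem s 1 by rewrite fr.1.
have e5 : nat_mem s' 5 = nat_mem s 5 by rewrite fr.1.
have fF : F - 1 - k < F by lia.
pose f : 'I_F := Ordinal fF.
have dropS : drop (F - k.+1) (enum 'I_F) = f :: drop (F - k) (enum 'I_F).
  have -> : F - k.+1 = F - 1 - k by lia.
  rewrite (drop_nth f) ?size_enum_ord // -[X in nth _ _ X]/(val f) nth_ord_enum.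
  by congr (_ :: drop _ _); lia.
apply: (@rt_seq _ _ _ _ (fun s1 => s1 = step (assign 13 (NSub (NSub (input_size 1) (NConst 1)) (var 10))) s')
   _ 30 (V * 300 + 320)); [exact: rt_step | | lia].
move=> s1 s1E _.
have a0 : nat_mem s1 0 = nat_mem s 0 by rewrite s1E -e0.
have a1 : nat_mem s1 1 = nat_mem s 1 by rewrite s1E -e1.
have a5 : nat_mem s1 5 = nat_mem s 5 by rewrite s1E -e5.
have a13 : nat_mem s1 13 0 0 = f by rewrite s1E /= updE e0 hF sk.
have em1 : emitted s1 (C (drop (F - k) (enum 'I_F))) by rewrite s1E; exact: Ik.
apply: (@rt_if _ _ _ _ _ _ (V * 300 + 300)); last by rewrite /=; lia.
  rewrite /= a0 a13 a5 hV addn1 => qV; pose q : 'I_V := Ordinal qV.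
  apply: (@rt_conseq _ _ _ _ _ (V * 300 + 300)); last by [].
    by apply: (@emit_blockP s1 _ F f q _ _ _ em1) => //; rewrite ?a0 ?a5.
  move=> s2 em2 _; rewrite /I dropS /C /= /pivot_opt.
  by rewrite (insubT (fun x => x < V) qV); move: em2; rewrite a1.
rewrite /= a0 a13 a5 hV addn1 => qV; apply: rt_step; [by []| |by rewrite /=; lia].
rewrite /I dropS /C /= /pivot_opt insubF ?cats0 //; exact: negbTE.
Qed.

End Emission.

(** * The algorithm *)

Definition rconst (k : nat) : rexp := RNat (NConst k).

Definition rcell (a j : nat) : rexp := RGet a (NConst 0) (NConst j).

Definition count_samples : cmd :=
  Seq (NSet 2 (NConst 0) (NConst 0) (NConst 0))
  (Seq (RSet 5 (NConst 0) (NConst 0)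
          (RMul (RAdd (RDiv (rconst 8) (RMul (rcell 0 1) (rcell 0 1))) (rconst 8))
                (RLn (RDiv (rconst 2) (RSub (rconst 1) (rcell 0 2))))))
       (While (BNot (BRealLe (rcell 5 0) (RNat (cell 2 0))))
          (NSet 2 (NConst 0) (NConst 0) (NAdd (cell 2 0) (NConst 1))))).

Definition sample_sum : cmd :=
  Seq (RSet 6 (NConst 0) (NConst 0) (rconst 0))
    (For 10 2 0
      (Seq (RSet 7 (NConst 0) (NConst 0) (rconst 1))
      (Seq (For 11 0 0 (RSet 7 (NConst 0) (NConst 0)
              (RMul (rcell 7 0) (RGet 2 (var 10) (var 11)))))
           (RSet 6 (NConst 0) (NConst 0) (RAdd (rcell 6 0) (rcell 7 0)))))).

Definition weight_product : cmd :=
  let e := RMul (RMul (rconst 2) (rcell 0 0)) (RGet 1 (NConst 0) (var 11)) in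
  Seq (RSet 8 (NConst 0) (NConst 0) (rconst 4))
    (For 11 0 0 (RSet 8 (NConst 0) (NConst 0)
      (RMul (rcell 8 0) (RSqrt (RAdd (RExp e) (RExp (RSub (rconst 0) e))))))).

Definition simulation : algorithm :=
  Algorithm (Seq eliminate (Seq emit_circuit count_samples))
    (Seq sample_sum (Seq weight_product
       (RSet 3 (NConst 0) (NConst 0)
          (RMul (rcell 8 0) (RDiv (rcell 6 0) (RNat (cell 2 0))))))).

Section Samples.
Variable R : realType.
Implicit Types s : Defs.mem R.

Definition threshold (eps p : R) : R := (8 / (eps * eps) + 8) * ln (2 / (1 - p)).

(** The inequality serves the accuracy; minimality makes the counting loop stop exactly at [K] and
    bounds the runtime. *)
Lemma least_nat_ge (x : R) :
  exists K : nat, x <= K%:R /\ forall k : nat, (k < K)%N -> k%:R < x.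
Proof.
have ex : exists n : nat, x <= n%:R.
  exists (Num.bound `|x|); apply: ltW; apply: (le_lt_trans (ler_norm x)).
  exact: archi_boundP.
exists (ex_minn ex); case: ex_minnP => K KP Kmin; split=> // k kK.
by rewrite ltNge; apply/negP => /Kmin; rewrite leqNgt kK.
Qed.

(** The gate count shares array 2 with the number of repetitions, so the frame does not protect it
    and its preservation is part of the conclusion. *)
Lemma count_samplesP s (eps p : R) K :
  real_mem s 0 0%N 1%N = eps -> real_mem s 0 0%N 2%N = p ->
  threshold eps p <= K%:R -> (forall k : nat, (k < K)%N -> k%:R < threshold eps p) ->
  runs_to count_samples s
    (fun s' => nat_mem s' 2 0 0 = K /\ nat_mem s' 2 0 1 = nat_mem s 2 0 1)%N
    (K * 20 + 100)%N.
Proof.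
move=> he hp hK hlt.
pose s1 := step (NSet 2 (NConst 0) (NConst 0) (NConst 0)) s.
apply: (@rt_seq _ _ _ _ (fun s' => s' = s1) _ 10 (K * 20 + 90)); [exact: rt_step | | lia].
move=> _ -> _.
pose c2 := RSet 5 (NConst 0) (NConst 0)
          (RMul (RAdd (RDiv (rconst 8) (RMul (rcell 0 1) (rcell 0 1))) (rconst 8))
                (RLn (RDiv (rconst 2) (RSub (rconst 1) (rcell 0 2))))).
apply: (@rt_seq _ _ _ _ (fun s' => s' = step c2 s1) _ 60 (K * 20 + 30)); [exact: rt_step | | lia].
move=> _ -> _.
have loop d : forall k s2, (k + d)%N = K -> nat_mem s2 2 0 0 = k ->
    real_mem s2 5 0%N 0%N = threshold eps p ->
    exists s3 t, [/\ exec (While (BNot (BRealLe (rcell 5 0) (RNat (cell 2 0))))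
          (NSet 2 (NConst 0) (NConst 0) (NAdd (cell 2 0) (NConst 1)))) s2 s3 t,
       nat_mem s3 2 0 0 = K, nat_mem s3 2 0 1 = nat_mem s2 2 0 1 & (t <= d * 20 + 20)%N].
  elim: d => [|d IHd] k s2 kd k2 x2.
    exists s2, 9%N; split; rewrite ?k2 -?kd ?addn0 //.
    apply: (@ExecWhileFalse R (BNot (BRealLe (rcell 5 0) (RNat (cell 2 0))))).
    by rewrite /= x2 k2 negbK -[k]addn0 kd.
  have [||s3 [t [e3 h1 h2 l3]]] :=
    IHd k.+1 (step (NSet 2 (NConst 0) (NConst 0) (NAdd (cell 2 0) (NConst 1))) s2) _ _ x2.
  - by rewrite addSnnS.
  - by rewrite /= updE k2 addn1.
  exists s3, (9 + 8 + t)%N; split=> //; last by lia.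
  apply: (@ExecWhileTrue R (BNot (BRealLe (rcell 5 0) (RNat (cell 2 0)))) _ s2 _ s3 8 t); last exact: e3.
    by rewrite /= x2 k2 -ltNge hlt // -kd; lia.
  exact: (@ExecNSet R s2 2 (NConst 0) (NConst 0) (NAdd (cell 2 0) (NConst 1))).
have [||s3 [t [e3 h1 h2 l3]]] := loop K 0%N (step c2 s1) (add0n K) _ _.
- by rewrite /= updE.
- by rewrite /= updE he hp.
exists s3, t; split=> //; [exact: exec_frame e3 | lia].
Qed.

Lemma sample_sumP s V K :
  nat_mem s 0 0 0 = V -> nat_mem s 2 0 0 = K ->
  runs_to sample_sum s (fun s' =>
    real_mem s' 6 0%N 0%N = \sum_(0 <= k < K) \prod_(0 <= a < V) real_mem s 2 k a)
    (K * (V * 100 + 100) + 50)%N.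
Proof.
move=> hV hK.
pose s1 := step (RSet 6 (NConst 0) (NConst 0) (rconst 0)) s.
apply: (@rt_seq _ _ _ _ (fun s' => s' = s1) _ 10 (K * (V * 100 + 100) + 40)); [exact: rt_step | | lia].
move=> _ -> _.
pose I n (s' : Defs.mem R) := real_mem s' 6 0%N 0%N =
  \sum_(0 <= k < n) \prod_(0 <= a < V) real_mem s 2 k a.
apply: (@rt_for _ _ _ _ _ _ K I (V * 100 + 80)) => //; last lia.
  by rewrite /I big_geq // /s1 /= updE.
move=> k s' kK fr sk Ik.
have sV : nat_mem s' 0 0 0 = V by rewrite fr.1.
have s2 : real_mem s' 2 = real_mem s 2 by rewrite fr.2.
pose s3 := step (RSet 7 (NConst 0) (NConst 0) (rconst 1)) s'.
apply: (@rt_seq _ _ _ _ (fun s' => s' = s3) _ 10 (V * 100 + 60)); [exact: rt_step | | lia].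
move=> _ -> _.
pose I' n (s' : Defs.mem R) := real_mem s' 7 0%N 0%N = \prod_(0 <= a < n) real_mem s 2 k a.
apply: (@rt_seq _ _ _ _ (I' V) _ (V * 80 + 12) 20); [ | | lia].
  apply: (@rt_for _ _ _ _ _ _ V I' 60) => //; last lia.
    by rewrite /I' big_geq // /s3 /= updE.
  move=> a s4 aV fr4 sa Ia.
  have s42 : real_mem s4 2 = real_mem s 2 by rewrite fr4.2.
  have s410 : nat_mem s4 10 0 0 = k by rewrite fr4.1.
  apply: rt_step => //.
  by rewrite /I' /= updE s42 s410 sa Ia big_nat_recr.
move=> s4 I4 fr4; apply: rt_step => //.
rewrite /I /= updE I4 big_nat_recr //; congr (_ + _).
by rewrite fr4.2 //; exact: Ik.
Qed.

Lemma weight_productP s V (beta : R) (J : 'I_V -> R) :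
  nat_mem s 0 0 0 = V -> real_mem s 0 0%N 0%N = beta ->
  (forall a : 'I_V, real_mem s 1 0%N a = J a) ->
  runs_to weight_product s (fun s' =>
    real_mem s' 8 0%N 0%N = 4 * \prod_a weight beta J a) (V * 100 + 50)%N.
Proof.
move=> hV hb hJ.
pose s1 := step (RSet 8 (NConst 0) (NConst 0) (rconst 4)) s.
apply: (@rt_seq _ _ _ _ (fun s' => s' = s1) _ 10 (V * 100 + 40)); [exact: rt_step | | lia].
move=> _ -> _.
pose I n (s' : Defs.mem R) := real_mem s' 8 0%N 0%N = 4 * \prod_(0 <= a < n)
  Num.sqrt (expR (2 * beta * real_mem s 1 0%N a) + expR (- (2 * beta * real_mem s 1 0%N a))).
apply: (@rt_conseq _ _ _ (I V)); last exact: leqnn; last first.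
  move=> s' -> _; rewrite big_mkord; congr (_ * _); apply: eq_bigr => a _.
  by rewrite hJ.
apply: (@rt_for _ _ _ _ _ _ V I 80) => //; last lia.
  by rewrite /I big_geq // mulr1 /s1 /= updE.
move=> a s' aV fr sa Ia.
have s0 : real_mem s' 0 = real_mem s 0 by rewrite fr.2.
have s1' : real_mem s' 1 = real_mem s 1 by rewrite fr.2.
apply: rt_step => //.
by rewrite /I /= updE Ia s0 s1' sa hb sub0r big_nat_recr //= mulrA.
Qed.

Lemma postP s V K (beta : R) (J : 'I_V -> R) :
  nat_mem s 0 0 0 = V -> nat_mem s 2 0 0 = K -> real_mem s 0 0%N 0%N = beta ->
  (forall a : 'I_V, real_mem s 1 0%N a = J a) ->
  runs_to (post simulation) s (fun s' => real_mem s' 3 0%N 0%N =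
    4 * \prod_a weight beta J a *
      ((\sum_(0 <= k < K) \prod_(0 <= a < V) real_mem s 2 k a) / K%:R))
    (K * (V * 100 + 100) + V * 100 + 150)%N.
Proof.
move=> hV hK hb hJ.
apply: (@rt_seq _ _ _ _ _ _ _ (V * 100 + 80) _ (sample_sumP hV hK)); last lia.
move=> s1 e1 fr1.
apply: (@rt_seq _ _ _ _ _ _ (V * 100 + 50) 30); [ | | lia].
  by apply: (@weight_productP s1 V beta J); rewrite ?fr1.1 // ?fr1.2 // => a; rewrite fr1.2.
move=> s2 e2 fr2; apply: rt_step => //=; rewrite updE e2 fr2.2 // e1 fr2.1 // fr1.1 // hK.
by [].
Qed.

End Samples.

(** * Correctness and runtime of the whole algorithm *)

Section Correctness.
Variables (R : realType) (V F : nat) (G : colex V F) (beta : R) (J : 'I_V -> R).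

Lemma column_equivalent_input (eps p : R) :
  column_equivalent R (face_bits G) (nat_mem (input_mem (incidence G) beta J eps p) 1).
Proof.
split=> /=.
- move=> i j; case: insub => // v; case: insub => // f; rewrite mxE.
  by case: incident.
- by move=> j; rewrite insubF ?ltnn.
move=> x; congr (amplitude R _ x); apply/boolp.funext => f; apply/ffunP => v.
by rewrite !ffunE /= !valK mxE; case: incident.
Qed.

Lemma size_prep_circuit (M : 'I_F -> bits V) piv (l : seq 'I_F) :
  (size (prep_circuit R M piv l) <= size l * V.+1)%N.
Proof.
elim: l => //= f l IHl; rewrite size_cat mulSn addnC leq_add //.
case: (piv f) => //= q; rewrite size_map ltnS size_filter.
by rewrite (leq_trans (count_size _ _)) ?size_enum_ord.
Qed.

Lemma compileP (eps p : R) K :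
  threshold eps p <= K%:R -> (forall k : nat, (k < K)%N -> k%:R < threshold eps p) ->
  exists circ : circuit R V,
    [/\ run_circuit circ = color_code_state R G, (size circ <= F * V.+1)%N &
      runs_to (compile simulation) (input_mem (incidence G) beta J eps p)
       (fun s => nat_mem s 2 0%N 0%N = K /\ stores_circuit s circ)
       (F * (F * (V * 100 + 100) + V * 100 + 200) + 12
         + (F * (V * 300 + 400) + 12 + (K * 20 + 100)))%N].
Proof.
move=> hK hlt; set s0 := input_mem _ _ _ _ _.
have [||s1 [t1 [e1 [eq1 piv1] fr1 l1]]] :=
  @eliminateP R s0 V F (face_bits G) _ _ (column_equivalent_input eps p) => //.
(* The circuit is read off the reduced matrix and the pivots that the elimination leaves in
   memory. *)
pose circ := prep_circuit R (@columns V F (nat_mem s1 1))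
  (@pivot_opt V (fun f => nat_mem s1 5 f 0%N) F) (enum 'I_F).
exists circ; split.
- apply: prep_color_code; last by case: eq1.
  move=> f; rewrite /pivot_opt; case: (piv1 f (ltn_ord f)) => -[h1 h2].
    move=> h3; rewrite insubT; split=> [|g fg]; rewrite ffunE //=.
    by rewrite h3 // fg ltn_ord.
  rewrite insubF ?h1 ?ltnn //; apply/ffunP => v; by rewrite !ffunE h2.
- by rewrite (leq_trans (size_prep_circuit _ _ _)) // size_enum_ord.
apply: (@rt_seq _ _ _ _ (fun s => s = s1) _ (F * (F * (V * 100 + 100) + V * 100 + 200) + 12)
  (F * (V * 300 + 400) + 12 + (K * 20 + 100))); [by exists s1, t1 | | exact: leqnn].
move=> _ -> _; have n0 : nat_mem s1 0 = nat_mem s0 0 by rewrite fr1.1.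
apply: (@rt_seq _ _ _ _ _ _ (F * (V * 300 + 400) + 12) (K * 20 + 100)); [ | |exact: leqnn].
  apply: (@emit_circuitP R V s1 F); rewrite ?n0 //.
  split=> [|k i _]; last by rewrite fr1.2.
  by split=> [|//|[|k] g //]; rewrite fr1.1.
move=> s2 [[sz ok st] _] fr2.
have r0 : real_mem s2 0 = real_mem s0 0 by rewrite fr2.2 // fr1.2.
apply: (@rt_conseq _ _ _ _ _ (K * 20 + 100)); last exact: leqnn.
  by apply: (@count_samplesP R s2 eps p K); rewrite ?r0.
move=> s3 [K3 c3] fr3; split=> //; split=> //; first by rewrite c3.
move=> k g /st; have n3 : nat_mem s3 3 = nat_mem s2 3 by rewrite fr3.1.
have e4 : entry s3 k = entry s2 k by apply/boolp.funext => j; rewrite /entry fr3.2.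
by case: g => [q U|q r U] /=; rewrite n3 e4.
Qed.

Definition estimate K (w : outcomes K V) : R :=
  4 * \prod_a weight beta J a * ((\sum_k \prod_a sign R (w k a)) / K%:R).

Lemma estimate_probability (eps p : R) K :
  0 < eps -> 0 <= p < 1 -> threshold eps p <= K%:R ->
  p <= probability (observable beta J) (color_code_state R G)
         (fun w : outcomes K V => `|estimate w - partition_function G beta J|
            <= gamma F beta J / Num.sqrt (2 ^ (F%:Z - 2)) * eps).
Proof.
move=> e0 p01 hK.
have w0 : 0 < \prod_a weight beta J a by apply: prodr_gt0 => a _; exact: weight_gt0.
have gE : gamma F beta J / Num.sqrt (2 ^ (F%:Z - 2)) = 4 * \prod_a weight beta J a.
  have y0 : 0 < Num.sqrt (2 ^ (F%:Z - 2)) :> R by rewrite sqrtr_gt0 exprz_gt0.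
  rewrite /gamma; have -> : 2 ^+ (F + 2) = 4 ^+ 2 * 2 ^ (F%:Z - 2) :> R.
    have -> : 2 ^ (F%:Z - 2) = 2 ^+ F / 2 ^+ 2 :> R by rewrite expfzDr ?pnatr_eq0.
    by rewrite exprD; field.
  move: y0; rewrite sqrtrM ?sqr_ge0 // sqrtr_sqr ger0_norm //.
  by move: (Num.sqrt (_ ^ _)) => y y0; field; rewrite lt0r_neq0.
pose P := born (observable beta J) (color_code_state R G).
pose g (x : bits V) := \prod_v sign R (x v).
have g1 x : `|g x| <= 1 by rewrite /g -sign_sum /sign normrX normrN1 expr1n.
have Pg : \sum_x P x * g x = partition_function G beta J / (4 * \prod_a weight beta J a).
  by rewrite -mean_born_color_code; apply: eq_bigr => x _; rewrite mulrC.
apply: (le_trans (hoeffding_samples (fun x => born_ge0 _ _ x)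
  (sum_born_color_code G beta J) g1 e0 p01 hK)).
apply: iid_le => [x|w]; first exact: born_ge0.
rewrite Pg gE => hw; rewrite /estimate /=.
have W0 : 0 < 4 * \prod_a weight beta J a by rewrite mulr_gt0.
have -> : 4 * \prod_a weight beta J a * ((\sum_k \prod_a sign R (w k a)) / K%:R) - partition_function G beta J =
   4 * \prod_a weight beta J a * ((\sum_k g (w k)) / K%:R - partition_function G beta J / (4 * \prod_a weight beta J a)).
  by rewrite mulrBr [X in _ = _ - X]mulrC divfK // lt0r_neq0.
by rewrite normrM gtr0_norm // ler_pM2l.
Qed.

End Correctness.

(** Elimination costs order [V ^ 3] once, and each repetition order [V ^ 2], mostly for its gates;
    the product [V ^ 3 * K] dominates the sum. *)
Lemma runtime_le (V F K n : nat) : (0 < V)%N -> (0 < K)%N -> (F <= 3 * V)%N -> (n <= F * V.+1)%N ->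
  (F * (F * (V * 100 + 100) + V * 100 + 200) + 12 + (F * (V * 300 + 400) + 12 + (K * 20 + 100))
   + K * (n + V) + (K * (V * 100 + 100) + V * 100 + 150) <= 100 * 100 * (V ^ 3 * K))%N.
Proof.
move=> V0 K0 FV nF.
have V2 : (V <= V ^ 2)%N by rewrite -[leqLHS]expn1 leq_pexp2l.
have V3 : (V ^ 2 <= V ^ 3)%N by rewrite leq_pexp2l.
have V1 : (1 <= V ^ 3)%N by lia.
have FV2 : (F * V <= 3 * V ^ 2)%N by rewrite expnS expn1 mulnA leq_mul2r FV orbT.
have FFV : (F * F * V <= 9 * V ^ 3)%N.
  rewrite (_ : 9 * V ^ 3 = (3 * V) * (3 * V) * V)%N ?leq_mul //.
  by rewrite !expnS expn0; lia.
have FF : (F * F <= 9 * V ^ 2)%N.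
  rewrite (_ : 9 * V ^ 2 = (3 * V) * (3 * V))%N ?leq_mul //.
  by rewrite !expnS expn0; lia.
have KV : (V ^ 3 <= V ^ 3 * K)%N by rewrite leq_pmulr.
have KK : (K <= V ^ 3 * K)%N by rewrite leq_pmull.
have K1 : (K * V <= V ^ 3 * K)%N by rewrite mulnC leq_mul2r (leq_trans V2 V3) orbT.
have K2 : (K * (F * V) <= 3 * (V ^ 3 * K))%N.
  rewrite (leq_trans (leq_mul (leqnn K) FV2)) //.
  by rewrite mulnCA leq_mul2l /= mulnC leq_mul2r V3 orbT.
have K3 : (K * F <= 3 * (V ^ 3 * K))%N.
  rewrite (leq_trans _ K2) // leq_mul2l leq_pmulr // orbT //.
have K4 : (K * n <= K * (F * V) + K * F)%N by rewrite -mulnDr leq_mul2l addnC -mulnS nF orbT.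
have -> : (F * (F * (V * 100 + 100) + V * 100 + 200) + 12 + (F * (V * 300 + 400) + 12 + (K * 20 + 100))
   + K * (n + V) + (K * (V * 100 + 100) + V * 100 + 150) =
   F * F * V * 100 + F * F * 100 + F * V * 400 + F * 600 + K * n + K * V * 101 + K * 120 + V * 100 + 274)%N.
  by ring.
lia.
Qed.

(** With [E = 1 / eps ^+ 2 >= 1] and [L >= ln 2 >= 2^-1], the threshold is at most [16 * E] times
    [2 * L], and rounding up costs at most [1 <= 2 * E * L]; together 34. *)
Lemma sample_count_le (R : realType) (eps p : R) (K : nat) :
  0 < eps <= 1 -> 2^-1 <= p < 1 -> (0 < K)%N ->
  (forall k : nat, (k < K)%N -> k%:R < threshold eps p) ->
  K%:R <= 34 * (1 / eps ^+ 2 * ln (1 / (1 - p))).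
Proof.
move=> /andP[e0 e1] /andP[p1 p2] K0 hlt; set L := ln (1 / (1 - p)).
have q0 : 0 < 1 - p by rewrite subr_gt0.
have hK : K%:R <= threshold eps p + 1.
  case: K K0 hlt => // k _ hlt; rewrite -natr1 lerD2r ltW //; exact: hlt.
have E1 : 1 <= 1 / eps ^+ 2 by rewrite ler_pdivlMr ?exprn_gt0 // mul1r expr_le1 // ltW.
have two : 2 <= 1 / (1 - p) by rewrite ler_pdivlMr //; lra.
(* At [2^-1] the quadratic bound on the exponential is exactly 2. *)
have ln2 : 2^-1 <= ln 2 :> R.
  rewrite -ler_expR lnK ?posrE //; apply: (le_trans (expR_le_quadratic (lexx _))); lra.
have ln2L : ln 2 <= L by rewrite ler_ln ?posrE ?divr_gt0.
have lnE : ln (2 / (1 - p)) = ln 2 + L.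
  by rewrite -[2 / _]/(2 * (1 - p)^-1) lnM ?posrE ?invr_gt0 // /L mul1r.
apply: (le_trans hK); rewrite /threshold lnE.
have -> : 8 / (eps * eps) = 8 * (1 / eps ^+ 2) by rewrite expr2 mul1r.
move: (1 / eps ^+ 2) E1 => E E1.
have h1 : 0 <= (E - 1) * L by apply: mulr_ge0; lra.
have h2 : 0 <= (E - 1) * (L - ln 2) by apply: mulr_ge0; lra.
nra.
Qed.

Theorem theorem4 (R : realType) :
  exists (A : algorithm) (c eps0 p0 : R) (V0 : nat),
    0 < eps0 /\ p0 < 1 /\
    forall (V F : nat) (G : colex V F) (beta : R) (J : 'I_V -> R) (eps p : R),
      0 <= beta -> 0 < eps -> 0 <= p < 1 ->
      exists (K : nat) (circ : circuit R V) (est : outcomes K V -> R) (T : nat),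
        [/\ runs A (input_mem (incidence G) beta J eps p) circ est T,
            run_circuit circ = color_code_state R G,
            p <= probability (observable beta J) (run_circuit circ)
                   (fun w : outcomes K V =>
                      `|est w - partition_function G beta J|
                        <= gamma F beta J / Num.sqrt (2 ^ (F%:Z - 2)) * eps)
          & (V0 <= V)%N -> eps <= eps0 -> p0 <= p ->
            T%:R <= c * (V%:R ^+ 3 * (1 / eps ^+ 2) * ln (1 / (1 - p)))].
Proof.
(* The constant combines [runtime_le] and [sample_count_le]; [eps <= 1] and [p >= 2^-1] are the
   conditions of the latter. *)
exists simulation, ((100 * 100)%:R * 34), 1, 2^-1, 0%N; split=> //; split; first lra.
move=> V F G beta J eps p b0 e0 p01; have [K [hK hlt]] := least_nat_ge (threshold eps p).
have [circ [circE szc [s1 [t1 [e1 [K1 st1] fr1 l1]]]]] := compileP G beta J hK hlt.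
have [p0 p1] := andP p01.
(* The 2 inside the logarithm keeps the threshold positive even at [p = 0]. *)
have K0 : (0 < K)%N.
  rewrite -(ltr0n R); apply: lt_le_trans hK; rewrite /threshold mulr_gt0 //.
    by rewrite addr_gt0 // divr_gt0 // mulr_gt0.
  by apply: ln_gt0; rewrite ltr_pdivlMr ?subr_gt0 //; lra.
pose T := (F * (F * (V * 100 + 100) + V * 100 + 200) + 12 + (F * (V * 300 + 400) + 12 + (K * 20 + 100))
   + K * (size circ + V) + (K * (V * 100 + 100) + V * 100 + 150))%N.
exists K, circ, (@estimate R V beta J K), T; split=> //.
- exists s1, t1; split=> // w.
  have [||||s2 [t2 [e2 X3 _ l2]]] := @postP R (store_outcomes s1 w) V K beta J.
  + by rewrite /= fr1.1.
  + by [].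
  + by rewrite /= fr1.2.
  + by move=> a; rewrite /= fr1.2 //= valK.
  exists s2, t2; split=> //; last by rewrite /T; lia.
  rewrite X3 /estimate big_mkord; congr (_ * (_ / _)); apply: eq_bigr => k _.
  by rewrite big_mkord; apply: eq_bigr => a _; rewrite /= !valK.
- by rewrite circE; exact: estimate_probability.
move=> _ eps1 p2.
have TK : T%:R <= (100 * 100)%:R * (V%:R ^+ 3 * K%:R) :> R.
  rewrite -natrX -!natrM ler_nat; apply: runtime_le => //.
    exact: nonempty G.
  exact: faces_le G.
have v0 : 0 <= V%:R ^+ 3 :> R by rewrite exprn_ge0.
move: (V%:R ^+ 3) v0 TK => v v0 TK; apply: (le_trans TK).
rewrite -(mulrA _ 34) ler_wpM2l ?ler0n // -(mulrA v) mulrCA ler_wpM2l //.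
by apply: sample_count_le; rewrite ?e0 ?p2.
Qed.
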